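(* For every $p\in[1,2]$ there is a constant $C_p>0$, independent of the dimension $n$ and the volume $\varepsilon$, such that for every $n\ge1$ and every $\varepsilon\in(0,\frac12)$, any two bodies $A$ and $B$ of volume $\varepsilon$ inside the unit-volume $\ell_p$ ball $\omega_n\ell_p^n$ are at a distance at most $$C_p\left(\log\frac1\varepsilon\right)^{\frac1p}.$$
   Context: $\ell_p^n=\{x\in\mathbb{R}^n : |x_1|^p+\dots+|x_n|^p\le1\}$ and $\omega_n=\frac{\Gamma(1+\frac np)^{1/n}}{2\Gamma(1+\frac1p)}$, so that $\omega_n\ell_p^n$ has Lebesgue measure $1$. Bodies are measurable subsets of $\omega_n\ell_p^n$; volume is Lebesgue measure; $\log$ is the natural logarithm. The distance between non-empty sets is $\operatorname{dist}(A,B)=\inf_{x\in A,\,y\in B}\|x-y\|_2$ (Euclidean distance). *)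

(* Defs.v *)
From HB Require Import structures.
From mathcomp Require Import all_boot all_order all_algebra.
From mathcomp Require Import all_classical all_reals all_analysis.

Set Implicit Arguments.
Unset Strict Implicit.
Unset Printing Implicit Defensive.

Import Order.TTheory GRing.Theory Num.Theory.
Import numFieldNormedType.Exports.

Local Open Scope classical_set_scope.
Local Open Scope ring_scope.

(* Tuples rather than row vectors: the library equips only the former with the
   product (Borel) sigma-algebra. *)
Notation Rvec R n := (n.-tuple (measurableTypeR R)).

Section lebesgue_measure_on_Rn.
Variable R : realType.

Definition Rvec_cons n (z : measurableTypeR R * Rvec R n) : Rvec R n.+1 :=
  cons_tuple z.1 z.2.

Let measurable_Rvec_cons n : measurable_fun setT (@Rvec_cons n).
Proof. exact: measurable_cons. Qed.

HB.instance Definition _ n :=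
  @isMeasurableFun.Build _ _ _ _ (@Rvec_cons n) (@measurable_Rvec_cons n).

Lemma Rvec_cons_preimage n (A : 'I_n.+1 -> set R) :
  @Rvec_cons n @^-1` [set x | forall i, A i (tnth x i)] =
  A ord0 `*` [set x : Rvec R n | forall i, A (lift ord0 i) (tnth x i)].
Proof.
apply/seteqP; split => [[a x] /= Aax|[a x] /= [Aa Ax] i].
  by split=> [|i]; [exact: (Aax ord0)|have := Aax (lift ord0 i); rewrite tnthS].
by case: (unliftP ord0 i) => [j|] ->; rewrite ?tnthS//; exact: Ax.
Qed.

Lemma measurable_box n (A : 'I_n -> set (measurableTypeR R)) :
  (forall i, measurable (A i)) ->
  measurable [set x : Rvec R n | forall i, A i (tnth x i)].
Proof.
move=> mA; rewrite (_ : [set _ | _] =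
    \bigcap_(i in [set: 'I_n]) ((fun x : Rvec R n => tnth x i) @^-1` A i)).
  apply: fin_bigcap_measurable => // i _; rewrite -[X in measurable X]setTI.
  exact: measurable_tnth.
by apply/seteqP; split => x /= Ax i; [move=> _; exact: Ax|exact: (Ax i I)].
Qed.

Section step.
Variables (n : nat) (mu : {sigma_finite_measure set (Rvec R n) -> \bar R}).

Definition lebesgue_step : set (Rvec R n.+1) -> \bar R :=
  pushforward (@lebesgue_measure R \x mu)%E (@Rvec_cons n).

Let lebesgue_step0 : lebesgue_step set0 = 0%E.
Proof. exact: measure0. Qed.

Let lebesgue_step_ge0 A : (0 <= lebesgue_step A)%E.
Proof. exact: measure_ge0. Qed.

Let lebesgue_step_sigma_additive : semi_sigma_additive lebesgue_step.
Proof. exact: measure_semi_sigma_additive. Qed.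

HB.instance Definition _ := isMeasure.Build _ _ _ lebesgue_step
  lebesgue_step0 lebesgue_step_ge0 lebesgue_step_sigma_additive.

Let lebesgue_step_sigma_finite : sigma_finite setT lebesgue_step.
Proof.
have /sigma_finiteP[F [TF ndF mF]] := sigma_finiteT (@lebesgue_measure R).
have /sigma_finiteP[G [TG ndG mG]] := sigma_finiteT mu.
pose g (x : Rvec R n.+1) : measurableTypeR R * Rvec R n :=
  (thead x, [tuple of behead x]).
have mg : measurable_fun setT g.
  by apply/measurable_fun_pairP; split; [exact: measurable_tnth|
    exact: measurable_behead].
have gK z : g (Rvec_cons z) = z.
  by case: z => a x; rewrite /g /Rvec_cons/= theadE; congr pair; exact: val_inj.
exists (fun k => g @^-1` (F k `*` G k)).
  rewrite -preimage_bigcup (_ : \bigcup_k _ = setT) ?preimage_setT//.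
  rewrite -subTset => -[a x] _.
  have [i _ Fia] : (\bigcup_k F k) a by rewrite -TF.
  have [j _ Gjx] : (\bigcup_k G k) x by rewrite -TG.
  exists (maxn i j) => //; split=> /=.
    by move: a Fia; exact/subsetPset/ndF/leq_maxl.
  by move: x Gjx; exact/subsetPset/ndG/leq_maxr.
move=> k; have [mFk Fkoo] := mF k; have [mGk Gkoo] := mG k; split.
  by rewrite -[X in measurable X]setTI; apply: mg => //; exact: measurableX.
rewrite /lebesgue_step /pushforward (_ : _ @^-1` _ = F k `*` G k).
  by rewrite product_measure1E// lte_mul_pinfty// ge0_fin_numE.
by rewrite -comp_preimage (_ : g \o _ = id)//; exact/funext/gK.
Qed.

HB.instance Definition _ := Measure_isSigmaFinite.Build _ _ _ lebesgue_step
  lebesgue_step_sigma_finite.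

End step.

Fixpoint borel_lebesgue n : {sigma_finite_measure set (Rvec R n) -> \bar R} :=
  if n is k.+1 then lebesgue_step (borel_lebesgue k) else \d_[tuple].

Lemma borel_lebesgue_box n (A : 'I_n -> set (measurableTypeR R)) :
  (forall i, measurable (A i)) ->
  borel_lebesgue n [set x | forall i, A i (tnth x i)] =
  (\prod_(i < n) lebesgue_measure (A i))%E.
Proof.
elim: n => [|n IH] in A *=> mA.
  by rewrite big_ord0 [LHS]diracE (_ : _ \in _)//; apply/mem_set; case.
rewrite big_ord_recl/= /lebesgue_step /pushforward Rvec_cons_preimage.
have mA' i : measurable (A (lift ord0 i)) by exact: mA.
rewrite product_measure1E; [|exact: mA|exact: measurable_box mA'].
by rewrite (IH _ mA').
Qed.

(* The library's completion of a measure: defined on the Caratheodory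
   measurable sets of the associated outer measure, i.e. here on the Lebesgue
   measurable subsets of R^n. *)
Definition lebesgue_Rn n :=
  @completed_measure_extension _ _ _ (borel_lebesgue n).

Lemma lebesgue_Rn_borel n (A : set (Rvec R n)) :
  measurable A -> lebesgue_Rn A = borel_lebesgue n A.
Proof. exact: measurable_mu_extE. Qed.

Definition lebesgue_measurable n (A : set (Rvec R n)) : Prop :=
  measurable (A : set (caratheodory_type (mu_ext (borel_lebesgue n)))).

End lebesgue_measure_on_Rn.

Section lp_balls.
Variable R : realType.

Definition Gamma (s : R) : R :=
  \int[lebesgue_measure]_(t in `]0, +oo[) (t `^ (s - 1) * expR (- t)).

Definition lp_ball (p : R) n : set (Rvec R n) :=
  [set x | \sum_(i < n) `|tnth x i : R| `^ p <= 1].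

(* The factor for which [dilate (omega p n) (lp_ball p n)] has volume 1. *)
Definition omega (p : R) n : R :=
  Gamma (1 + n%:R / p) `^ n%:R^-1 / (2 * Gamma (1 + p^-1)).

Definition dilate (a : R) n (A : set (Rvec R n)) : set (Rvec R n) :=
  map_tuple ( *%R a) @` A.

Definition euclidean_dist n (x y : Rvec R n) : R :=
  Num.sqrt (\sum_(i < n) ((tnth x i : R) - tnth y i) ^+ 2).

Definition set_dist n (A B : set (Rvec R n)) : R :=
  inf [set euclidean_dist x y | x in A & y in B].

End lp_balls.
Arguments lp_ball {R} p n.

(* Main.v *)
Require Import Defs.
From HB Require Import structures.
From mathcomp Require Import all_boot all_order all_algebra.
From mathcomp Require Import all_classical all_reals all_analysis.
From mathcomp Require Import measurable_realfun.
From mathcomp Require Import ring lra.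

(** The theorem reduces to concentration for a product measure.  Let
    [rho x = expR (- (`|x| `^ p))], of total mass [Zrho = 2 Gamma(1 + 1/p)],
    and let [rhon] be the product density on R^n.

    The inequality behind the concentration is [infconv]: if
    f(x) g(y) <= exp(c sum_i cost(x_i - y_i)) for all x and y, where
    cost(s) = min((|s|/2)^2, (|s|/2)^p), then the product of the integrals of
    f and g against [rhon] is at most [Zrho ^+ (2 * n)].  It passes from one
    coordinate to n coordinates by integrating one coordinate at a time, so
    only n = 1 has to be understood ([infconv_1D]).  There, let N be the
    distribution function of [rho] / [Zrho], let U = 1 - N, and use the
    coordinate arc = asin(2 N - 1), for which cos(arc) = 2 sqrt(N U) and
    d arc / dx = rho / (Zrho sqrt(N U)).  For F = f cos(arc) and
    G = g cos(arc) the claim becomes that the integrals of F and G with respect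
    to d arc have product at most 4.  By [two_point_gain] the factor
    exp(c cost(x - y)) is absorbed:

      F(x) G(y) <= cos((arc x + arc y) / 2)^2.

    After a rescaling that gives F and G the same supremum, the level sets
    {F > s} and {G > s} are both non-empty for the same s, and all midpoints
    between them, in the arc coordinate, lie in an interval of half-length
    acos(s).  Hence their lengths add up to at most 4 acos(s), and integration
    over s in [0, 1] gives 4 ([prekopa_arc]).  The gain of [two_point_gain] comes
    from the tails: t^p is superadditive for p >= 1, so
    U(z + h) <= exp(- h^p) U(z) and (1 + h/Zrho) U(z + h) <= U(z) for
    z, h >= 0, and the odds N/U grow at least at a definite rate.

    For p <= 2, two points at Euclidean distance at least D >= 2 have total cost
    at least (D/2)^p ([euclidean_cost_ge]); so the masses of two sets at
    distance D have product at most Zrho^(2n) exp(- c (D/2)^p)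
    ([concentration]).

    It remains to compare the ball with the product measure.  On the set of
    pairs (g, t) with |g_1|^p + ... + |g_n|^p < t, weighted by exp(- t), the
    marginal in g has density [rhon], while t^(-1/p) g is uniform in the unit
    ball and independent of t, whose law is that of a Gamma variable of shape
    al = 1 + n/p.  A body A in the normalized ball therefore gives a set of
    points g that are carried into A by some factor omega t^(-1/p) with t in the
    window al - 4 sqrt(al) <= t <= al + 4 sqrt(al), and the mass of this set is
    at least a constant times vol(A) Zrho^n ([lift_set], [gamma_window],
    [lifted_mass]).  Concentration at
    D ~ (log(1/eps))^(1/p) provides points g and h of the two lifted sets with
    |g - h| <= D.  The two factors are bounded by a constant and differ by
    O(n^(-1/2)), so the images of g and h in the two bodies are at distance
    O(D + n^(-1/2) |h|).  Finally |h| can be taken O(sqrt(n) + D), by Markov's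
    inequality and a second use of concentration ([far_mass]).  In the
    dimensions where al is bounded the diameter of the ball is enough, since
    log(1/eps) is bounded below. *)

Import Order.TTheory GRing.Theory Num.Theory.
Import numFieldNormedType.Exports.

Set Implicit Arguments.
Unset Strict Implicit.
Unset Printing Implicit Defensive.

Local Open Scope classical_set_scope.
Local Open Scope ring_scope.

(** * Integration on the line *)

Section affine.
Variable R : realType.
Local Notation mu := (@lebesgue_measure R).

Lemma lebesgue_measure_itvcc (a b : R) : a <= b -> mu `[a, b]%classic = (b - a)%:E.
Proof.
move=> ab; rewrite lebesgue_measure_itv/= lte_fin; case: ltP => // ba.
by have -> : a = b; [apply/eqP; rewrite eq_le ab ba|rewrite subrr].
Qed.

(** Lebesgue measure is determined by its values on intervals, and s times its
    image under x |-> s x + b has the same ones. *)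
Lemma ge0_integral_affine (s b : R) (f : R -> \bar R) : 0 < s ->
  measurable_fun [set: R] f -> (forall x, (0 <= f x)%E) ->
  (\int[mu]_x f (s * x + b)%R = (s^-1)%:E * \int[mu]_x f x)%E.
Proof.
move=> s0 mf f0.
pose h : measurableTypeR R -> measurableTypeR R := fun x => s * x + b.
have mh : measurable_fun setT h.
  by apply: measurable_funD => //; exact: mulrl_measurable.
have sV0 : 0 <= s by exact: ltW.
pose nu' := mscale (NngNum sV0) (pushforward mu h) : {measure set (measurableTypeR R) -> \bar R}.
pose nu := nu' mh.
have E A : measurable A -> mu A = nu A.
  move=> mA; apply: lebesgue_measure_unique => //= _ [[x y]] _ <-.
  rewrite /mscale/= /pushforward.
  have -> : h @^-1` `]x, y] = `](x - b) / s, (y - b) / s]%classic.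
    apply/seteqP; split => z /=; rewrite /h !in_itv/=.
    - by rewrite ltr_pdivrMr// ler_pdivlMr// (mulrC z) ltrBlDr lerBrDr.
    - by rewrite ltr_pdivrMr// ler_pdivlMr// (mulrC z) ltrBlDr lerBrDr.
  rewrite !lebesgue_measure_itv/= !lte_fin ltr_pM2r ?invr_gt0// ltrD2r.
  case: ifPn => _; last by rewrite mule0.
  by rewrite -EFinD -EFinM -mulrBl addrAC opprD opprK; congr EFin; field; rewrite gt_eqF.
rewrite [X in _ = (_ * X)%E](_ : _ = (s%:E * \int[mu]_x f (h x))%E).
  by rewrite muleA -EFinM mulVf ?gt_eqF// mul1e.
transitivity (\int[nu]_x f x)%E.
  by apply: eq_measure_integral => A mA _; exact: E.
rewrite ge0_integral_mscale//=.
by rewrite ge0_integral_pushforward.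
Qed.
End affine.

Section layer_cake.
Context {R : realType} d (T : measurableType d).
Variable nu : {sigma_finite_measure set T -> \bar R}.
Local Notation mu := (@lebesgue_measure R).

(** Tonelli's theorem on the set of pairs (x, s) with 0 <= s < F x. *)
Lemma layer_cake (F w : T -> R) :
  measurable_fun setT F -> measurable_fun setT w ->
  (forall x, 0 <= F x) -> (forall x, 0 <= w x) ->
  (\int[nu]_x (F x * w x)%:E =
   \int[mu]_(s in `[0%R, +oo[) \int[nu]_(x in [set x | (s < F x)%R]) (w x)%:E)%E.
Proof.
move=> mF mw F0 w0.
pose h (z : T * measurableTypeR R) : \bar R :=
  if (0 <= z.2) && (z.2 < F z.1) then (w z.1)%:E else 0%E.
have mh : measurable_fun setT h.
  apply: measurable_fun_ifT; last exact: measurable_cst.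
    apply: measurable_and; first exact: measurable_fun_ler.
    by apply: measurable_fun_ltr => //; exact: measurableT_comp.
  by apply/measurable_EFinP; exact: measurableT_comp.
have h0 z : (0 <= h z)%E by rewrite /h; case: ifP => // _; rewrite lee_fin.
transitivity (\int[nu]_x \int[mu]_s h (x, s))%E.
  apply: eq_integral => x _.
  have -> : (\int[mu]_s h (x, s) = \int[mu]_(s in `[0%R, F x[) (cst (w x)%:E s))%E.
    rewrite [RHS]integral_mkcond; apply: eq_integral => s _.
    by rewrite patchE /h mem_setE in_itv.
  rewrite integral_cst//= lebesgue_measure_itv/= lte_fin.
  have [Fx0|Fx0] := ltP 0 (F x); first by rewrite oppr0 adde0 -EFinM mulrC.
  have -> : F x = 0 by apply/eqP; rewrite eq_le Fx0 F0.
  by rewrite mul0r mule0.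
rewrite (fubini_tonelli _ mh h0) [RHS]integral_mkcond; apply: eq_integral => s _.
rewrite patchE mem_setE in_itv/= andbT; case: ifPn => s0.
  rewrite [RHS]integral_mkcond; apply: eq_integral => x _.
  rewrite patchE /h/= s0/=; case: ifPn => [sF|/negP sF]; first by rewrite mem_set.
  by rewrite memNset.
by rewrite integral0_eq// => x _; rewrite /h/= (negbTE s0).
Qed.

Lemma measurable_layer (F w : T -> R) :
  measurable_fun setT F -> measurable_fun setT w -> (forall x, 0 <= w x) ->
  measurable_fun [set: measurableTypeR R]
    (fun s => \int[nu]_(x in [set x | (s < F x)%R]) (w x)%:E)%E.
Proof.
move=> mF mw w0.
pose h (z : T * measurableTypeR R) : \bar R :=
  if z.2 < F z.1 then (w z.1)%:E else 0%E.
have mh : measurable_fun setT h.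
  apply: measurable_fun_ifT; last exact: measurable_cst.
    by apply: measurable_fun_ltr => //; exact: measurableT_comp.
  by apply/measurable_EFinP; exact: measurableT_comp.
have h0 z : (0 <= h z)%E by rewrite /h; case: ifP => // _; rewrite lee_fin.
apply: eq_measurable_fun (measurable_fun_fubini_tonelli_G (m1 := nu) h mh h0) => s _.
rewrite /fubini_G [RHS]integral_mkcond; apply: eq_integral => x _.
rewrite patchE /h/=; case: ifPn => [sF|/negP sF]; first by rewrite mem_set.
by rewrite memNset.
Qed.

End layer_cake.

(** * Integration on R^n, one coordinate at a time *)

Section Rvec_integral.
Variable R : realType.
Local Notation mu := (@lebesgue_measure R).

Lemma measurable_comp_cons n (f : Rvec R n.+1 -> \bar R) :
  measurable_fun setT f -> measurable_fun setT (f \o @Rvec_cons R n).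
Proof. by move=> mf; apply: (measurableT_comp mf); exact: measurable_funP. Qed.

Lemma integral_Rvec_cons n (f : Rvec R n.+1 -> \bar R) :
  measurable_fun setT f -> (forall x, 0 <= f x)%E ->
  (\int[borel_lebesgue R n.+1]_x f x =
   \int[mu]_a \int[borel_lebesgue R n]_v f (Rvec_cons (a, v)))%E.
Proof.
move=> mf f0.
have mfc := measurable_comp_cons mf.
rewrite -(fubini_tonelli1 _ mfc); last by move=> z; exact: f0.
by rewrite /= /lebesgue_step ge0_integral_pushforward.
Qed.

Lemma measurable_section_integral n (f : Rvec R n.+1 -> \bar R) :
  measurable_fun setT f -> (forall x, 0 <= f x)%E ->
  measurable_fun [set: R] (fun a => \int[borel_lebesgue R n]_v f (Rvec_cons (a, v)))%E.
Proof.
move=> mf f0.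
apply: (measurable_fun_fubini_tonelli_F (m2 := borel_lebesgue R n) (f \o @Rvec_cons R n)) => [|z].
  exact: measurable_comp_cons.
exact: f0.
Qed.

Lemma integral_Rvec0 (f : Rvec R 0 -> \bar R) : measurable_fun setT f ->
  (\int[borel_lebesgue R 0]_x f x = f [tuple])%E.
Proof. by move=> mf; rewrite integral_dirac// diracE mem_set// mul1e. Qed.

Lemma measurable_Rvec_section n (f : Rvec R n.+1 -> \bar R) (a : measurableTypeR R) :
  measurable_fun setT f -> measurable_fun setT (fun v => f (Rvec_cons (a, v))).
Proof.
move=> mf; apply: (measurableT_comp (f := f \o @Rvec_cons R n)); last exact: measurable_pair1.
exact: measurable_comp_cons.
Qed.

End Rvec_integral.

Section scaling.
Variable R : realType.
Local Notation mu := (@lebesgue_measure R).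

Lemma map_tuple_cons n (s : R) (a : measurableTypeR R) (v : Rvec R n) :
  map_tuple ( *%R s) (Rvec_cons (a, v)) =
  Rvec_cons (s * (a : R), map_tuple ( *%R s) v) :> Rvec R n.+1.
Proof. by apply: val_inj. Qed.

Lemma measurable_scale n :
  measurable_fun setT (fun z : measurableTypeR R * Rvec R n =>
    map_tuple ( *%R (z.1 : R)) z.2 : Rvec R n).
Proof.
apply/measurable_fun_tnthP => i.
rewrite (_ : _ \o _ = (fun z : measurableTypeR R * Rvec R n => (z.1 : R) * tnth z.2 i)); last first.
  by apply/funext => z /=; rewrite tnth_map.
apply: measurable_funM => //.
exact: (measurableT_comp (measurable_tnth i)).
Qed.

Lemma measurable_scale1 n (s : R) :
  measurable_fun setT (fun x : Rvec R n => map_tuple ( *%R s) x : Rvec R n).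
Proof.
apply/measurable_fun_tnthP => i.
rewrite (_ : _ \o _ = (fun z : Rvec R n => s * (tnth z i : R))); last first.
  by apply/funext => z /=; rewrite tnth_map.
apply: measurable_funM => //; exact: measurable_tnth.
Qed.

Lemma ge0_integral_scale n (s : R) (f : Rvec R n -> \bar R) : 0 < s ->
  measurable_fun setT f -> (forall x, 0 <= f x)%E ->
  (\int[borel_lebesgue R n]_x f (map_tuple ( *%R s) x) =
   (s ^- n)%:E * \int[borel_lebesgue R n]_x f x)%E.
Proof.
move=> s0; elim: n => [|n IH] in f *; move=> mf f0.
  rewrite !integral_Rvec0//; last by apply: (measurableT_comp mf); exact: measurable_scale1.
  by rewrite expr0 invr1 mul1e; congr f; apply: val_inj.
rewrite !integral_Rvec_cons//; last first.
  by apply: (measurableT_comp mf); exact: measurable_scale1.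
pose F (a : R) : \bar R := (\int[borel_lebesgue R n]_v f (Rvec_cons (a : measurableTypeR R, v)))%E.
have mF : measurable_fun [set: R] F by exact: measurable_section_integral.
have F0 a : (0 <= F a)%E by exact: integral_ge0.
transitivity (\int[mu]_a ((s ^- n)%:E * F (s * a + 0)%R))%E.
  apply: eq_integral => a _; rewrite addr0 -IH//.
    by apply: eq_integral => v _; rewrite map_tuple_cons.
  exact: measurable_Rvec_section.
have mFs : measurable_fun [set: measurableTypeR R] (fun a => F (s * a + 0)).
  by apply: (measurableT_comp mF); apply: measurable_funD.
rewrite ge0_integralZl; [|exact: measurableT|exact: mFs|by []|]; last first.
  by rewrite lee_fin invr_ge0 exprn_ge0// ltW.
rewrite ge0_integral_affine// muleA -EFinM; congr (_%:E * _)%E.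
by rewrite exprS invfM mulrC.
Qed.

End scaling.

(** * The exponential weight *)

Section exponential.
Variable R : realType.
Local Notation mu := (@lebesgue_measure R).

Lemma measurable_expR_norm : measurable_fun [set: R] (fun x : R => expR (- (`|x| / 2))).
Proof.
apply: measurableT_comp => //; apply: measurableT_comp => //.
by apply: measurable_funM => //; exact: measurableT_comp.
Qed.

Lemma integral_expR_half : (\int[mu]_(x in `[0%R, +oo[) (expR (- (x / 2)))%:E = 2%:E)%E.
Proof.
have h0 : 0 < (2^-1 : R) by rewrite invr_gt0.
transitivity (\int[mu]_x (2%:E * (exponential_pdf 2^-1 x)%:E))%E.
  rewrite integral_mkcond; apply: eq_integral => x _.
  rewrite patchE mem_setE in_itv/= andbT; case: ifPn => x0.
    by rewrite exponential_pdfE// -EFinM mulrA divff// mul1r mulNr mulrC.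
  by rewrite lt0_exponential_pdf ?mule0// ltNge.
rewrite ge0_integralZl//.
- by rewrite integral_exponential_pdf ?mule1.
- by apply/measurable_EFinP; exact: measurable_exponential_pdf.
- by move=> x _; rewrite lee_fin exponential_pdf_ge0 // ltW.
Qed.

Lemma integral_expR_norm_lty : (\int[mu]_x (expR (- (`|x| / 2)))%:E < +oo)%E.
Proof.
rewrite ge0_symfun_integralT; first last.
- by move=> x; rewrite /= normrN.
- move=> x; apply: continuous_comp; last exact: continuous_expR.
  apply: continuousN; apply: continuousM; [exact: norm_continuous|exact: cst_continuous].
- by move=> x; rewrite expR_ge0.
rewrite (_ : (\int[mu]_(x in [set x | (0 <= x)%R]) _ = 2%:E)%E); first by rewrite -EFinM ltry.
rewrite -set_itvcy -integral_expR_half; apply: eq_integral => x.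
by rewrite inE/= in_itv/= andbT => x0; rewrite ger0_norm.
Qed.

End exponential.

(** * Borel parts of Lebesgue measurable sets *)

Section borel_inner.
Variable R : realType.

(** The measure is an infimum over Borel covers, so covers approximate from
    outside.  Removing from a box that contains A an almost optimal cover of the
    rest of the box leaves a Borel part of A. *)
Lemma borel_inner n (A : set (Rvec R n)) (k e : R) : 0 < e ->
  lebesgue_measurable A -> lebesgue_Rn A = e%:E ->
  (forall x i, A x -> - k <= (tnth x i : R) <= k) ->
  exists A0 : set (Rvec R n), [/\ measurable A0, A0 `<=` A &
    ((e / 2)%:E <= borel_lebesgue R n A0)%E].
Proof.
move=> e0 mA lA Ak.
pose Q := [set x : Rvec R n | forall i, (`[- k, k]%classic : set R) (tnth x i)].
have mQ : measurable Q.
  by apply: (@measurable_box R n (fun=> `[- k, k]%classic)) => i; exact: measurable_itv.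
have lQ : borel_lebesgue R n Q \is a fin_num.
  rewrite /Q (@borel_lebesgue_box R n (fun=> `[- k, k]%classic)); last first.
    by move=> i; exact: measurable_itv.
  elim/big_ind : _ => //; first by move=> x y; exact: fin_numM.
  by move=> i _; rewrite lebesgue_measure_itv; case: ifP.
have AQ : A `<=` Q by move=> x Ax i; rewrite /= in_itv/=; exact: Ak.
have := mA Q.
rewrite (_ : Q `&` A = A); last exact/setIidPr.
rewrite [X in (X + _)%E](_ : _ = e%:E); last exact: lA.
rewrite [LHS](_ : _ = borel_lebesgue R n Q); last exact: measurable_mu_extE.
rewrite -setDE => lQE.
have e20 : 0 < e / 2 by rewrite divr_gt0.
set m := (X in _ = (_ + X)%E) in lQE.
have mE : m = (borel_lebesgue R n Q - e%:E)%E.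
  by rewrite lQE addeAC -EFinB subrr add0e.
have mfin : m \is a fin_num by rewrite mE fin_numB lQ.
have [_ [F [mF FQ] <-] HF] := @lb_ereal_inf_adherent R _ (e / 2) e20 mfin.
exists (Q `\` \bigcup_k (F k)).
have mUF : measurable (\bigcup_k (F k)) by exact: bigcup_measurable.
split.
- exact: measurableD.
- by move=> x [Qx FNx]; apply: contrapT => Ax; apply: FNx; apply: FQ.
have lF : (borel_lebesgue R n (\bigcup_k (F k)) <= m + (e / 2)%:E)%E.
  apply: le_trans (ltW HF); exact: measure_sigma_subadditive.
have : (borel_lebesgue R n Q <= borel_lebesgue R n (Q `\` \bigcup_k (F k)) + (m + (e / 2)%:E))%E.
  apply: le_trans (leeD2l _ lF).
  rewrite [leLHS](measureDI (borel_lebesgue R n) mQ mUF).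
  by rewrite leeD2l// le_measure ?inE//; exact: measurableI.
rewrite mE; move: lQ; case: (borel_lebesgue R n Q) => [q| |]// _.
case: (borel_lebesgue R n _) => [z| |]; rewrite ?leey//.
by rewrite -EFinB -!EFinD !lee_fin; lra.
Qed.

End borel_inner.

(** * The Gamma integral and its mass near the mean *)

Section gamma_window.
Variable R : realType.
Local Notation mu := (@lebesgue_measure R).

(** From u <= exp(u) at u = t / (2 a), raised to the power a.  It reduces the
    convergence of the Gamma integral to that of exp(- t/2). *)
Lemma powR_le_expR (a t : R) : 0 < a -> 0 < t -> t `^ a <= (2 * a) `^ a * expR (t / 2).
Proof.
move=> a0 t0; have a20 : 0 < 2 * a by rewrite mulr_gt0.
have -> : t `^ a = (2 * a) `^ a * (t / (2 * a)) `^ a.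
  by rewrite -powRM ?(ltW a20) ?divr_ge0 ?(ltW t0) ?(ltW a20)// mulrC divfK ?gt_eqF.
rewrite ler_wpM2l ?powR_ge0//.
have -> : expR (t / 2) = expR (t / (2 * a)) `^ a.
  by rewrite -expRM; congr expR; field; rewrite gt_eqF.
rewrite ge0_ler_powR ?nnegrE ?(ltW a0) ?expR_ge0 ?divr_ge0 ?(ltW t0) ?(ltW a20)//.
by apply: le_trans (expR_ge1Dx _); rewrite lerDr.
Qed.

Lemma measurable_gamma (a : R) (l : R) (D : set R) :
  measurable_fun D (fun t : R => (t `^ a * expR (- (l * t)))%:E).
Proof.
apply: (measurable_funS (E := setT)) => //; apply/measurable_EFinP.
apply: measurable_funM; first exact: measurable_powR.
by apply: measurableT_comp => //; apply: measurableT_comp => //.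
Qed.

Lemma gamma_ge0 (a l t : R) : (0 <= (t `^ a * expR (- (l * t)))%:E)%E.
Proof. by rewrite lee_fin mulr_ge0 ?powR_ge0 ?expR_ge0. Qed.

Lemma gamma_integral_le (a : R) : 0 < a ->
  (\int[mu]_(t in `]0%R, +oo[) (t `^ a * expR (- (1 * t)))%:E <= (2 * (2 * a) `^ a)%:E)%E.
Proof.
move=> a0.
apply: (@le_trans _ _ (\int[mu]_(t in `]0%R, +oo[) (((2 * a) `^ a)%:E * (expR (- (t / 2)))%:E))%E).
  apply: ge0_le_integral; first exact: measurable_itv.
  - by move=> t _; exact: gamma_ge0.
  - exact: measurable_gamma.
  - apply: (measurable_funS (E := setT)) => //.
    apply: emeasurable_funM => //; apply/measurable_EFinP; apply: measurableT_comp => //.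
    by apply: measurableT_comp => //; exact: measurable_funM.
  - move=> t; rewrite /= in_itv/= andbT => t0; rewrite -EFinM lee_fin.
    have := ler_wpM2r (expR_ge0 (- (1 * t))) (powR_le_expR a0 t0).
    by rewrite -mulrA -expRD (_ : t / 2 + - (1 * t) = - (t / 2))//; field.
have mE (D : set R) : measurable_fun D (fun t : R => (expR (- (t / 2)))%:E).
  apply: (measurable_funS (E := setT)) => //; apply/measurable_EFinP.
  by apply: measurableT_comp => //; apply: measurableT_comp => //; exact: measurable_funM.
rewrite ge0_integralZl//.
- rewrite integral_itv_obnd_cbnd; last exact: mE.
  by rewrite integral_expR_half -EFinM (mulrC _ 2) lexx.
- exact: mE.
- by rewrite lee_fin powR_ge0.
Qed.

Lemma gamma_integralE (a : R) : 0 < a ->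
  (\int[mu]_(t in `]0%R, +oo[) (t `^ a * expR (- (1 * t)))%:E = (Gamma (1 + a))%:E)%E.
Proof.
move=> a0; rewrite /Gamma /Rintegral.
have -> : (\int[mu]_(t in `]0%R, +oo[) (t `^ (1 + a - 1) * expR (- t))%:E =
           \int[mu]_(t in `]0%R, +oo[) (t `^ a * expR (- (1 * t)))%:E)%E.
  by apply: eq_integral => t _; rewrite mul1r addrC addrA addNr add0r.
rewrite fineK// ge0_fin_numE; last by apply: integral_ge0 => t _; exact: gamma_ge0.
by apply: le_lt_trans (gamma_integral_le a0) _; rewrite ltry.
Qed.

Lemma Gamma_le (a : R) : 0 < a -> Gamma (1 + a) <= 2 * (2 * a) `^ a.
Proof. by move=> a0; rewrite -lee_fin -gamma_integralE// gamma_integral_le. Qed.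

Lemma Gamma_ge0 (a : R) : 0 < a -> 0 <= Gamma (1 + a).
Proof.
move=> a0; rewrite -lee_fin -gamma_integralE//; apply: integral_ge0 => t _.
exact: gamma_ge0.
Qed.

Lemma Gamma_gt0 (a : R) : 0 < a -> 0 < Gamma (1 + a).
Proof.
move=> a0; rewrite -lte_fin -gamma_integralE//.
apply: (@lt_le_trans _ _ (\int[mu]_(t in `[1%R, 2%R]) (cst (expR (- (2 : R)))%:E t))%E).
  rewrite integral_cst; last exact: measurable_itv.
  rewrite [X in (_ * X)%E]lebesgue_measure_itvcc ?ler1n// -EFinM lte_fin mulr_gt0 ?expR_gt0//.
apply: (@le_trans _ _ (\int[mu]_(t in `[1%R, 2%R]) (t `^ a * expR (- (1 * t)))%:E)%E).
  apply: ge0_le_integral; first exact: measurable_itv.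
  - by move=> t _; rewrite lee_fin expR_ge0.
  - exact: measurable_cst.
  - exact: measurable_gamma.
  move=> t; rewrite /= in_itv/= => /andP[t1 t2]; rewrite lee_fin mul1r.
  have ta : 1 <= t `^ a by rewrite -[leLHS](powRr0 t) ler_powR// ltW.
  apply: (@le_trans _ _ (expR (- t))); first by rewrite ler_expR lerN2.
  by rewrite ler_peMl// expR_ge0.
apply: ge0_subset_integral;
  [exact: measurable_itv|exact: measurable_itv|exact: measurable_gamma| |].
- by move=> t _; exact: gamma_ge0.
- by move=> t /=; rewrite !in_itv/= andbT => /andP[/(lt_le_trans ltr01)].
Qed.

Lemma gamma_rate (a l : R) : 0 < a -> 0 < l ->
  (\int[mu]_(t in `]0%R, +oo[) (t `^ a * expR (- (l * t)))%:E =
   (l `^ (- (1 + a)) * Gamma (1 + a))%:E)%E.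
Proof.
move=> a0 l0.
pose f := (fun t : R => (t `^ a * expR (- (1 * t)))%:E) \_ `]0%R, +oo[.
have mf : measurable_fun [set: R] f.
  by apply/(measurable_restrictT _ _).1 => //; exact: measurable_gamma.
have f0 t : (0 <= f t)%E by apply: erestrict_ge0 => ? _; exact: gamma_ge0.
have la : l `^ (- (1 + a)) = l^-1 * l `^ (- a).
  rewrite opprD powRD ?(gt_eqF l0) ?implybT//; congr (_ * _).
  by rewrite powRN powRr1// ltW.
rewrite la -mulrA EFinM.
have := ge0_integral_affine 0 l0 mf f0.
have -> : (\int[mu]_x f x = (Gamma (1 + a))%:E)%E.
  by rewrite /f -integral_mkcond gamma_integralE.
move=> H.
have lna : 0 < l `^ (- a) by exact: powR_gt0.
rewrite (EFinM (l `^ (- a))) muleCA -H -ge0_integralZl//; last 2 first.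
- apply: (measurableT_comp mf); exact: measurable_funD.
- by rewrite lee_fin ltW.
rewrite [LHS]integral_mkcond; apply: eq_integral => t _.
rewrite /f !patchE !mem_setE !in_itv/= !andbT addr0 pmulr_rgt0//.
case: ifPn => t0; last by rewrite mule0.
rewrite -EFinM mul1r powRM ?(ltW l0) ?(ltW t0)// mulrA; congr (_ * _)%:E.
by rewrite mulrA -powRD ?(gt_eqF l0) ?implybT// addNr powRr0 mul1r.
Qed.

Lemma powR_neg_le (b y al : R) : 0 <= al -> expR (- y) <= b -> b `^ (- al) <= expR (al * y).
Proof.
move=> al0 yb; have b0 : 0 < b by apply: lt_le_trans yb; exact: expR_gt0.
rewrite /powR (gt_eqF b0) ler_expR mulNr lerNl -mulrN ler_wpM2l//.
by rewrite -(expRK (- y)) ler_ln ?posrE ?expR_gt0.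
Qed.

Lemma expR2_ge4 : 4 <= expR 2 :> R.
Proof.
by have := expR_ge1Dx (1 : R); rewrite (_ : 2 = 1 + 1 :> R)// expRD; nra.
Qed.

(** Chernoff's bound.  Outside the window one of the weights
    exp(+-(t - al)/r - 4) is at least 1.  Their integrals are Gamma integrals of
    rates 1 -+ 1/r, and (1 -+ 1/r)^(- al) is at most exp(+-r + 2) because
    al = r^2 and r >= 8; so each side loses at most exp(- 2) Gamma(al), less than a
    quarter. *)
Lemma gamma_window (a al r : R) : 0 < a -> al = 1 + a -> r = Num.sqrt al -> 64 <= al ->
  ((Gamma al / 2)%:E <=
   \int[mu]_(t in `[(al - 4 * r)%R, (al + 4 * r)%R]) (t `^ a * expR (- t))%:E)%E.
Proof.
move=> a0 alE rE al64.
have r2 : r ^+ 2 = al by rewrite rE sqr_sqrtr//; lra.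
have r0 : 0 <= r by rewrite rE sqrtr_ge0.
have r8 : 8 <= r by nra.
pose th := r^-1.
have rth : r * th = 1 by rewrite /th divff// gt_eqF//; lra.
have th0 : 0 < th by rewrite invr_gt0; lra.
have th8 : th <= 8^-1 by rewrite lef_pV2 ?posrE//; lra.
clearbody th.
have alth : al * th = r by rewrite -r2 expr2 -mulrA rth mulr1.
have G0 := Gamma_ge0 a0; rewrite -alE in G0.
have inv_le (y b : R) : 0 < 1 + y -> 1 <= b * (1 + y) -> expR (- y) <= b.
  move=> y1 by1; rewrite expRN; apply: (@le_trans _ _ (1 + y)^-1).
    by rewrite lef_pV2 ?posrE ?expR_gt0// expR_ge1Dx.
  by rewrite -[leLHS]mul1r ler_pdivrMr.
have al0 : 0 <= al by lra.
have up : expR (- (r + 4)) * (1 - th) `^ (- al) <= 4^-1.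
  have := @powR_neg_le (1 - th) (th + 2 * th ^+ 2) al al0.
  move=> /(_ (inv_le _ _ _ _)) H.
  have {}H : (1 - th) `^ (- al) <= expR (al * (th + 2 * th ^+ 2)) by apply: H; nra.
  apply: le_trans (ler_wpM2l (expR_ge0 _) H) _; rewrite -expRD.
  rewrite (_ : _ + _ = - 2); last by rewrite -r2; nra.
  by rewrite expRN lef_pV2 ?posrE ?expR_gt0// expR2_ge4.
have dn : expR (r - 4) * (1 + th) `^ (- al) <= 4^-1.
  have := @powR_neg_le (1 + th) (- th + th ^+ 2) al al0.
  move=> /(_ (inv_le _ _ _ _)) H.
  have {}H : (1 + th) `^ (- al) <= expR (al * (- th + th ^+ 2)) by apply: H; nra.
  apply: le_trans (ler_wpM2l (expR_ge0 _) H) _; rewrite -expRD.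
  apply: (@le_trans _ _ (expR (- 2))).
    by rewrite ler_expR -r2; nra.
  by rewrite expRN lef_pV2 ?posrE ?expR_gt0// expR2_ge4.
(* The weight tilted to rate l; the tilts by l = 1 -+ th dominate on the two
   sides of W. *)
pose w (l t : R) : \bar R := (t `^ a * expR (- (l * t)))%:E.
pose W : set R := `[(al - 4 * r), (al + 4 * r)]%classic.
have lo0 : 0 < al - 4 * r by nra.
have main : ((Gamma al)%:E <= \int[mu]_(t in W) w 1%R t +
   ((expR (- (r + 4)))%:E * ((1 - th) `^ (- al) * Gamma al)%:E +
    (expR (r - 4))%:E * ((1 + th) `^ (- al) * Gamma al)%:E))%E.
  pose D : set R := `]0%R, +oo[%classic.
  have th1 : 0 < 1 - th by lra.
  have th2 : 0 < 1 + th by lra.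
  have := gamma_integralE a0; rewrite -alE => <-.
  have := gamma_rate a0 th1; rewrite -alE => <-.
  have := gamma_rate a0 th2; rewrite -alE => <-.
  have mw l (X : set R) : measurable_fun X (w l) by exact: measurable_gamma.
  have w0 l t : (0 <= w l t)%E by exact: gamma_ge0.
  have mwW (X : set R) : measurable_fun X ((w 1%R) \_ W).
    apply: (measurable_funS (E := setT)) => //.
    by apply/(measurable_restrictT _ _).1; [exact: measurable_itv|exact: mw].
  have wW0 t : (0 <= ((w 1%R) \_ W) t)%E by apply: erestrict_ge0.
  have EW : (\int[mu]_(t in W) w 1%R t = \int[mu]_(t in D) ((w 1%R) \_ W) t)%E.
    rewrite integral_mkcond [RHS]integral_mkcond; apply: eq_integral => t _.
    rewrite [RHS]patchE; case: ifPn => // tD; rewrite patchE ifN//.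
    apply: contra tD; rewrite /W /D !mem_setE !in_itv/= andbT => /andP[+ _].
    exact: lt_le_trans.
  have pull k l : ((expR k)%:E * \int[mu]_(t in D) w l t =
      \int[mu]_(t in D) ((expR k)%:E * w l t))%E.
    by rewrite ge0_integralZl//; [exact: measurable_itv|exact: mw].
  rewrite EW (pull _ (1 - th)) (pull _ (1 + th)).
  have m1 k l (X : set R) : measurable_fun X (fun t => (expR k)%:E * w l t)%E.
    by apply: emeasurable_funM => //; exact: mw.
  have p1 k l t : (0 <= (expR k)%:E * w l t)%E.
    by rewrite mule_ge0// lee_fin expR_ge0.
  rewrite -ge0_integralD//; [|exact: measurable_itv|exact: m1|exact: m1].
  rewrite -ge0_integralD//; try solve [exact: measurable_itv|exact: mwW
    |by move=> t _; rewrite adde_ge0|by apply: emeasurable_funD; exact: m1].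
  apply: ge0_le_integral; first exact: measurable_itv.
  - by move=> t _; exact: w0.
  - exact: mw.
  - by apply: emeasurable_funD; [exact: mwW|apply: emeasurable_funD; exact: m1].
  move=> t; rewrite /= in_itv/= andbT => t0.
  have [tW|tW] := boolP (t \in W).
    by rewrite patchE tW leeDl// adde_ge0// p1.
  rewrite patchE (negbTE tW) add0e.
  have key k l : 0 <= k + (1 - l) * t -> (w 1%R t <= (expR k)%:E * w l t)%E.
    move=> kl; rewrite /w -EFinM lee_fin mulrCA ler_wpM2l ?powR_ge0// -expRD ler_expR; nra.
  have [tlo|thi] := ltP t (al - 4 * r).
    apply: le_trans (key (r - 4) (1 + th) _) _; first by nra.
    by rewrite leeDr// p1.
  have {}thi : al + 4 * r < t.
    by move: tW; rewrite /W mem_setE in_itv/= thi/= -ltNge.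
  apply: le_trans (key (- (r + 4)) (1 - th) _) _; first by nra.
  by rewrite leeDl// p1.
have wE : (\int[mu]_(t in W) w 1%R t = \int[mu]_(t in W) (t `^ a * expR (- t))%:E)%E.
  by apply: eq_integral => t _; rewrite /w mul1r.
rewrite wE in main.
move: main; case: (integral _ _ _) => [I| |]; rewrite ?leey//.
rewrite -!EFinM -!EFinD !lee_fin !mulrA => main.
have := ler_wpM2r G0 up; have := ler_wpM2r G0 dn; lra.
Qed.

End gamma_window.

(** * The density exp(- |x|^p) and its tails *)

Section density.
Variables (R : realType) (p : R).
Hypothesis p1 : 1 <= p.
Local Notation mu := (@lebesgue_measure R).

Let p0 : 0 < p. Proof. exact: lt_le_trans ltr01 p1. Qed.

Definition rho (x : R) : R := expR (- (`|x| `^ p)).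

Lemma rho_gt0 x : 0 < rho x. Proof. exact: expR_gt0. Qed.
Lemma rho_ge0 x : 0 <= rho x. Proof. exact: expR_ge0. Qed.

Lemma rhoN x : rho (- x) = rho x. Proof. by rewrite /rho normrN. Qed.

(** a^p <= a for a in [0, 1]; apply this to the proportions of x and y in
    x + y. *)
Lemma powR_superadd (x y : R) : 0 <= x -> 0 <= y -> x `^ p + y `^ p <= (x + y) `^ p.
Proof.
move=> x_ge0 y_ge0.
have [->|xn0] := eqVneq x 0; first by rewrite powR0 ?gt_eqF// !add0r.
have [->|yn0] := eqVneq y 0; first by rewrite powR0 ?gt_eqF// !addr0.
have x0 : 0 < x by rewrite lt_neqAle eq_sym xn0.
have y0 : 0 < y by rewrite lt_neqAle eq_sym yn0.
have xy0 : 0 < x + y by rewrite addr_gt0.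
have H z : 0 < z -> z <= x + y -> z `^ p <= z / (x + y) * (x + y) `^ p.
  move=> z0 zxy.
  rewrite -[z in z `^ p](divfK (lt0r_neq0 xy0))  powRM ?(divr_ge0 (ltW z0) (ltW xy0)) ?(ltW xy0)//.
  by rewrite ler_wpM2r ?powR_ge0// ge1r_powR// divr_gt0//= ler_pdivrMr// mul1r.
have := lerD (H x x0 _) (H y y0 _).
rewrite -mulrDl -mulrDl divff ?gt_eqF// mul1r; apply.
  by rewrite lerDl ltW.
by rewrite lerDr ltW.
Qed.

Lemma continuous_norm_powR : continuous (fun x : R => `|x| `^ p).
Proof.
move=> x; have [->|x0] := eqVneq x 0; last first.
  apply: (@continuous_comp _ _ _ (fun x : R => `|x|) (fun y => y `^ p)).
    exact: norm_continuous.
  apply: differentiable_continuous; apply/derivable1_diffP.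
  by apply: derivable_powR; rewrite in_itv/= normr_gt0 x0.
rewrite /continuous_at normr0 powR0 ?gt_eqF//.
apply/cvgrPdist_le => e e0.
have m0 : 0 < Num.min e 1 by rewrite lt_min e0 ltr01.
exists (Num.min e 1) => // y /=; rewrite sub0r normrN => /ltW yle.
rewrite sub0r normrN ger0_norm ?powR_ge0//.
have [->|y0] := eqVneq y 0; first by rewrite normr0 powR0 ?gt_eqF// ltW.
move: yle; rewrite le_min => /andP[ye y1].
by apply: le_trans ye; apply: ge1r_powR => //; rewrite normr_gt0 y0.
Qed.

Lemma continuous_rho : continuous rho.
Proof.
move=> x; apply: continuous_comp; last exact: continuous_expR.
by apply: continuousN; exact: continuous_norm_powR.
Qed.

Lemma measurable_rho : measurable_fun [set: R] rho.
Proof. by apply: continuous_measurable_fun; exact: continuous_rho. Qed.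

Lemma measurable_Erho (D : set R) : measurable_fun D (EFin \o rho).
Proof.
apply: (@measurable_funS _ _ _ _ setT) => //.
by apply/measurable_EFinP; exact: measurable_rho.
Qed.

(** Hence [rho x] is at most exp(1 - |x|), for every p >= 1. *)
Lemma le_norm_powR (x : R) : `|x| - 1 <= `|x| `^ p.
Proof.
have [x1|x1] := leP 1 `|x|.
  by rewrite (le_trans _ (le1r_powR _ _)) ?lerBlDr ?lerDl.
by rewrite (le_trans _ (powR_ge0 _ _)) // subr_le0 ltW.
Qed.

Lemma integral_rho_lty : (\int[mu]_x (rho x)%:E < +oo)%E.
Proof.
apply: (@le_lt_trans _ _ (\int[mu]_x ((expR 1)%:E * (expR (- (`|x| / 2)))%:E))%E).
  apply: ge0_le_integral => //.
  - by move=> x _; rewrite lee_fin rho_ge0.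
  - exact: measurable_Erho.
  - by apply: emeasurable_funM => //; apply/measurable_EFinP; exact: measurable_expR_norm.
  - move=> x _; rewrite -EFinM lee_fin -expRD ler_expR.
    by have := le_norm_powR x; have := normr_ge0 x; lra.
rewrite ge0_integralZl//.
- by apply: lte_mul_pinfty => //; exact: integral_expR_norm_lty.
- by apply/measurable_EFinP; exact: measurable_expR_norm.
Qed.

Definition Zrho : R := fine (\int[mu]_x (rho x)%:E).

Lemma integral_rhoE : (\int[mu]_x (rho x)%:E = Zrho%:E)%E.
Proof.
rewrite fineK// ge0_fin_numE ?integral_rho_lty//.
by apply: integral_ge0 => x _; rewrite lee_fin rho_ge0.
Qed.

Lemma integrable_rho (D : set R) : measurable D -> mu.-integrable D (EFin \o rho).
Proof.
move=> mD; apply: (@integrableS _ _ _ mu setT) => //.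
apply/integrableP; split; first exact: measurable_Erho.
under eq_integral do rewrite /= ger0_norm ?rho_ge0//.
exact: integral_rho_lty.
Qed.

Lemma Zrho_gt0 : 0 < Zrho.
Proof.
rewrite -lte_fin -integral_rhoE.
apply: (@lt_le_trans _ _ (\int[mu]_(x in `[0%R, 1%R]) (cst (expR (- 1)%R)%:E x))%E).
  rewrite integral_cst//= lebesgue_measure_itv/= lte_fin ltr01 oppr0 adde0 mule1.
  by rewrite lte_fin expR_gt0.
apply: (@le_trans _ _ (\int[mu]_(x in `[0%R, 1%R]) (rho x)%:E)%E).
  apply: ge0_le_integral => //.
  - by move=> x _; rewrite lee_fin expR_ge0.
  - exact: measurable_Erho.
  - move=> x /=; rewrite in_itv/= => /andP[x0 x1]; rewrite lee_fin ler_expR lerN2.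
    rewrite ger0_norm//; apply: (@le_trans _ _ (1 `^ p)); last by rewrite powR1.
    by rewrite ge0_ler_powR// ?nnegrE// ltW.
apply: ge0_subset_integral => //; first exact: measurable_Erho.
by move=> x _; rewrite lee_fin rho_ge0.
Qed.

Definition cdf_rho (x : R) : R := Zrho^-1 * \int[mu]_(t in `]-oo, x]) rho t.

Definition tail_rho (x : R) : R := Zrho^-1 * \int[mu]_(t in `]x, +oo[) rho t.

Lemma cdf_tail x : cdf_rho x + tail_rho x = 1.
Proof.
rewrite /cdf_rho /tail_rho -mulrDr -Rintegral_setU//=; first last.
- rewrite disj_set2E; apply/eqP/seteqP; split => // z [/=]; rewrite !in_itv/= andbT => zx.
  by rewrite ltNge zx.
- by apply: integrable_rho; exact: measurableU.
rewrite -setCitvl setUv.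
by rewrite /Rintegral -/Zrho mulVf// gt_eqF// Zrho_gt0.
Qed.

Lemma is_derive_cdf (x : R) : is_derive x 1 cdf_rho (rho x / Zrho).
Proof.
have [dF F'] := @continuous_FTC1 R rho -oo%O x (x + 1) (ltr_pwDr ltr01 (lexx x))
  (integrable_rho (measurable_itv _)) (ltNyr _) (@continuous_rho x).
have D : is_derive x 1 (fun x => \int[mu]_(t in `]-oo, x]) rho t) (rho x).
  by apply: DeriveDef; [exact: dF|rewrite -derive1E; exact: F'].
by have := is_deriveZ Zrho^-1 D; rewrite /GRing.scale/= mulrC.
Qed.

Lemma tail_integralE x : (Zrho * tail_rho x)%:E = (\int[mu]_(t in `]x, +oo[) (rho t)%:E)%E.
Proof.
rewrite /tail_rho mulrA divff ?mul1r ?gt_eqF ?Zrho_gt0// fineK//.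
by apply: integrable_fin_num => //; exact: integrable_rho.
Qed.

Lemma cdfN x : cdf_rho (- x) = tail_rho x.
Proof.
rewrite /cdf_rho /tail_rho; congr (_ * fine _).
rewrite (@ge0_integration_by_substitutionNy R rho x).
- rewrite -integral_itv_obnd_cbnd.
    by apply: eq_integral => y _ /=; rewrite rhoN.
  rewrite (_ : (fun _ => _) = EFin \o rho); first exact: measurable_Erho.
  by apply/funext => y /=; rewrite rhoN.
- exact: continuous_subspaceT continuous_rho.
- by move=> y _; exact: rho_ge0.
Qed.

Lemma ge0_integral_tail_shift (f : R -> \bar R) (x h : R) :
  measurable_fun [set: R] f -> (forall y, (0 <= f y)%E) ->
  (\int[mu]_(t in `](x + h)%R, +oo[) f t = \int[mu]_(t in `]x, +oo[) f (t + h)%R)%E.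
Proof.
move=> mf f0; rewrite integral_mkcond [RHS]integral_mkcond/=.
have := @ge0_integral_affine R 1 h (f \_ `](x + h)%R, +oo[) ltr01.
rewrite invr1 mul1e => <-; last first.
- by move=> y; apply: erestrict_ge0.
- by apply/(measurable_restrictT _ _).1 => //; exact: measurable_funTS.
apply: eq_integral => y _; rewrite mul1r !patchE !mem_setE !in_itv/= !andbT.
by rewrite ltrD2r.
Qed.

#[local] Opaque cdf_rho tail_rho.

Lemma tail_gt0 x : 0 < tail_rho x.
Proof.
rewrite -(pmulr_rgt0 _ Zrho_gt0) -lte_fin tail_integralE.
apply: (@lt_le_trans _ _ (\int[mu]_(t in `]x, (x + 1)%R]) (cst (rho (`|x| + 1)%R)%:E t))%E).
  rewrite integral_cst//= lebesgue_measure_itv/= lte_fin ltrDl ltr01.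
  by rewrite -EFinD addrAC subrr add0r mule1 lte_fin rho_gt0.
apply: (@le_trans _ _ (\int[mu]_(t in `]x, (x + 1)%R]) (rho t)%:E)%E).
  apply: ge0_le_integral; first exact: measurable_itv.
  - by move=> t _; rewrite lee_fin rho_ge0.
  - exact: measurable_cst.
  - exact: measurable_Erho.
  - move=> t /=; rewrite in_itv/= => /andP[xt tx1]; rewrite lee_fin ler_expR lerN2.
    rewrite ge0_ler_powR ?nnegrE// ?(ltW p0)// [leRHS]ger0_norm ?addr_ge0//.
    by rewrite ler_norml; move: (ler_norm x) (ler_norm (- x)); rewrite normrN; lra.
apply: ge0_subset_integral => //; first exact: measurable_Erho.
- by move=> t _; rewrite lee_fin rho_ge0.
- by apply: subset_itvl; rewrite bnd_simp.
Qed.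

Lemma cdf_gt0 x : 0 < cdf_rho x.
Proof. by rewrite -(opprK x) cdfN tail_gt0. Qed.

Lemma le_tail x y : x <= y -> tail_rho y <= tail_rho x.
Proof.
move=> xy; rewrite -(ler_pM2l Zrho_gt0) -lee_fin !tail_integralE.
apply: ge0_subset_integral => //; first exact: measurable_Erho.
- by move=> t _; rewrite lee_fin rho_ge0.
- by apply: subset_itvr; rewrite bnd_simp.
Qed.

Lemma le_cdf x y : x <= y -> cdf_rho x <= cdf_rho y.
Proof.
by move=> xy; rewrite -(opprK x) -(opprK y) !cdfN le_tail// lerN2.
Qed.

(** For y, h >= 0, superadditivity says that
    [rho (y + h) <= rho h * rho y]; integrate in y over [x, +oo[. *)
Lemma tail_shift x h : 0 <= x -> 0 <= h -> tail_rho (x + h) <= rho h * tail_rho x.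
Proof.
move=> x0 h0; rewrite -(ler_pM2l Zrho_gt0) [leRHS]mulrCA -lee_fin.
rewrite tail_integralE EFinM tail_integralE.
rewrite ge0_integral_tail_shift//; last 2 first.
- exact: measurable_Erho.
- by move=> y; rewrite lee_fin rho_ge0.
rewrite -ge0_integralZl//; last 3 first.
- exact: measurable_Erho.
- by move=> y _; rewrite lee_fin rho_ge0.
- by rewrite lee_fin rho_ge0.
apply: ge0_le_integral => //.
- by move=> y _; rewrite lee_fin rho_ge0.
- apply: (@measurable_funS _ _ _ _ setT) => //.
  apply: (@measurableT_comp _ _ _ _ _ _ (EFin \o rho) _ 
    (fun y : measurableTypeR R => y + h)); first exact: measurable_Erho.
  exact: measurable_funD.
- by apply/measurable_EFinP/measurable_funM => //; apply: measurable_funTS; exact: measurable_rho.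
move=> y /=; rewrite in_itv/= andbT => xy; rewrite -EFinM lee_fin -expRD ler_expR.
have y0 : 0 <= y by rewrite ltW// (le_lt_trans x0).
by rewrite !ger0_norm ?addr_ge0// -opprD lerN2 addrC powR_superadd.
Qed.

Lemma tail_le1 x : tail_rho x <= 1.
Proof. by rewrite -(cdf_tail x) lerDr ltW// cdf_gt0. Qed.

(** As [rho] decreases on [0, +oo[, the segment from x to x + h carries at least
    h [rho (x + h)], which dominates h times the tail at x + h by [tail_shift]
    from 0.  This is the useful bound for small h, where [tail_shift] only gains
    h^p. *)
Lemma tail_linear x h : 0 <= x -> 0 <= h -> (1 + h / Zrho) * tail_rho (x + h) <= tail_rho x.
Proof.
move=> x0 h0; have Z0 := Zrho_gt0.
have xh0 : 0 <= x + h by rewrite addr_ge0.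
have le_rho : tail_rho (x + h) <= rho (x + h).
  have := tail_shift (lexx 0) xh0; rewrite add0r => /le_trans; apply.
  by rewrite ler_piMr ?rho_ge0 ?tail_le1.
suff : h * rho (x + h) + Zrho * tail_rho (x + h) <= Zrho * tail_rho x.
  move=> H; rewrite mulrDl mul1r -(ler_pM2l Z0) mulrDr.
  apply: le_trans H; rewrite addrC lerD2r [leLHS](_ : _ = h * tail_rho (x + h)).
    by rewrite ler_wpM2l.
  by field; rewrite gt_eqF.
rewrite -lee_fin EFinD !tail_integralE.
rewrite (_ : `]x, +oo[%classic = `]x, x + h] `|` `](x + h), +oo[)%classic; last first.
  by rewrite -itv_bndbnd_setU// bnd_simp lerDl.
rewrite ge0_integral_setU; first last.
- rewrite disj_set2E; apply/eqP/seteqP; split => // z [/=]; rewrite !in_itv/= andbT => /andP[_ zx].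
  by rewrite ltNge zx.
- by move=> y _; rewrite lee_fin rho_ge0.
- exact: measurable_Erho.
- exact: measurable_itv.
- exact: measurable_itv.
rewrite leeD2r//.
apply: (@le_trans _ _ (\int[mu]_(t in `]x, (x + h)%R]) (cst (rho (x + h)%R)%:E t))%E).
  rewrite integral_cst//= lebesgue_measure_itv/= lte_fin ltrDl.
  have [h1|h1] := ltP 0 h; first by rewrite -EFinD addrAC subrr add0r -EFinM mulrC.
  by rewrite mule0 lee_fin mulr_le0_ge0// rho_ge0.
apply: ge0_le_integral; first exact: measurable_itv.
- by move=> t _; rewrite lee_fin rho_ge0.
- exact: measurable_cst.
- exact: measurable_Erho.
- move=> t /=; rewrite in_itv/= => /andP[xt tx1]; rewrite lee_fin ler_expR lerN2.
  have t0 : 0 <= t by rewrite ltW// (le_lt_trans x0).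
  by rewrite ge0_ler_powR ?nnegrE// ?(ltW p0)// !ger0_norm.
Qed.

(** Only the half of the segment from x to y that lies on the outer side of the
    midpoint m is used: for m >= 0 the upper tail decays from m to y, and for
    m < 0 the lower one decays from m to x, by symmetry.  The other factors are
    monotone. *)
Lemma odds_growth (k x y : R) : 0 <= k -> x <= y ->
  (forall z, 0 <= z -> k * tail_rho (z + (y - x) / 2) <= tail_rho z) ->
  k * (cdf_rho x * tail_rho y) <= cdf_rho y * tail_rho x.
Proof.
move=> k0 xy H.
have N0 z := ltW (cdf_gt0 z). have U0 z := ltW (tail_gt0 z).
have [m0|m0] := leP 0 ((x + y) / 2).
  have := H _ m0; rewrite (_ : (x + y) / 2 + (y - x) / 2 = y); last by field.
  move=> Hy; rewrite mulrCA ler_pM ?(mulr_ge0 k0 (U0 _)) ?le_cdf//.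
  by apply: le_trans Hy _; apply: le_tail; lra.
have m1 : 0 <= - ((x + y) / 2) by lra.
have Hy : k * cdf_rho x <= cdf_rho ((x + y) / 2).
  have E z : cdf_rho z = tail_rho (- z) by rewrite -cdfN opprK.
  rewrite !E.
  by have := H _ m1; rewrite (_ : - ((x + y) / 2) + (y - x) / 2 = - x); last by field.
rewrite mulrA ler_pM ?(mulr_ge0 k0 (N0 _)) ?U0//.
  by apply: le_trans Hy _; apply: le_cdf; lra.
exact: le_tail.
Qed.

(** * The two-point inequality *)

Lemma expR_le_1D2x (u : R) : 0 <= u <= 2^-1 -> expR u <= 1 + 2 * u.
Proof.
move=> /andP[u0 u1]; have := expR_ge1Dx (- u); rewrite expRN => H.
have e0 : 0 < expR u by exact: expR_gt0.
have : (1 - u) * expR u <= 1.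
  by rewrite -(ler_pdivlMr _ _ e0) div1r.
by nra.
Qed.

(** The two regimes of [contraction_factor], at half the step because
    [odds_growth] uses half of it. *)
Definition cost (s : R) : R := Num.min ((`|s| / 2) ^+ 2) ((`|s| / 2) `^ p).

(** With r = exp(y), (1 + r)^2 / (4 r) = cosh(y/2)^2 grows like exp(y); the
    constant 400 leaves room for y near 1/2, where the gain is smallest
    relative to y. *)
Lemma gain_exp (d y : R) : 0 <= d -> 400 * d <= 1 -> 2^-1 <= y ->
  4 * expR y * expR (2 * (d * y)) <= (1 + expR y) ^+ 2.
Proof.
move=> d0 d1 y1; have [y4|y4] := leP y 4.
  have r0 : 3 / 2 <= expR y by have := expR_ge1Dx y; lra.
  have : expR (2 * (d * y)) <= 1 + 2 * (2 * (d * y)).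
    by apply: expR_le_1D2x; nra.
  move: r0; move: (expR y) => r r0; move: (expR _) => e he.
  have : e <= 1 + 24^-1 by nra.
  nra.
have h1 : expR (2 * (d * y)) <= expR (y / 2) by rewrite ler_expR; nra.
have h2 : 4 <= expR (y / 2).
  have := expR_ge1Dx (y / 4); rewrite (_ : y / 2 = y / 4 + y / 4); last by field.
  by rewrite expRD; nra.
have := expRD (y / 2) (y / 2); rewrite -splitr => ->.
move: h1 h2; move: (expR (y / 2)) => t; move: (expR _) => e h1 h2.
have : 4 * e <= t * t by nra.
by move: (t * t) (mulr_ge0 (le_trans (ler0n _ 4) h2) (le_trans (ler0n _ 4) h2)) => u u0; nra.
Qed.

(** The odds grow by the factor r^2 over a step 2 h.  For h <= 1 take
    r = 1 + c1 h, from [tail_linear]: then (1 + r)^2 / (4 r) exceeds 1 by a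
    multiple of h^2.  For h > 1 take r = exp(h^p / 2), from [tail_shift], and
    use [gain_exp]. *)
Lemma contraction_factor : exists2 c : R, 0 < c & forall h, 0 <= h ->
  exists r, [/\ 1 <= r, forall z, 0 <= z -> r ^+ 2 * tail_rho (z + h) <= tail_rho z
    & 4 * r * expR (c * Num.min (h ^+ 2) (h `^ p)) <= (1 + r) ^+ 2].
Proof.
have Z0 := Zrho_gt0.
pose c1 := (3 * (1 + Zrho))^-1.
have c10 : 0 < c1 by rewrite invr_gt0; lra.
have c11 : c1 * (3 * (1 + Zrho)) = 1 by rewrite mulVf// gt_eqF//; lra.
have c13 : c1 <= 1 / 3 by nra.
clearbody c1.
have [d d0 dE] : exists2 d : R, 0 < d & 400 * d = 1.
  exists 400^-1; first by rewrite invr_gt0 ltr0n.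
  by apply: mulfV; rewrite pnatr_eq0.
have C0 : 0 < c1 ^+ 2 * d by rewrite mulr_gt0// exprn_gt0.
exists (c1 ^+ 2 * d) => // h h0.
have [h1|h1] := leP h 1.
  have c1h : 0 <= c1 * h <= 1.
    by rewrite (mulr_ge0 (ltW c10) h0)/=; nra.
  exists (1 + c1 * h); split; first by rewrite lerDl; case/andP: c1h.
    move=> z z0; apply: le_trans (tail_linear z0 h0).
    rewrite ler_wpM2r ?(ltW (tail_gt0 _))//.
    have : 3 * (c1 * h) <= h / Zrho.
      rewrite ler_pdivlMr//; have := mulr_ge0 h0 (ltW c10); nra.
    by move: (c1 * h) (h / Zrho) c1h => t u ht hu; nra.
  have m1 : Num.min (h ^+ 2) (h `^ p) <= h ^+ 2 by rewrite ge_min lexx.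
  have e1 : expR (c1 ^+ 2 * d * Num.min (h ^+ 2) (h `^ p)) <= expR (c1 ^+ 2 * d * h ^+ 2).
    by rewrite ler_expR ler_wpM2l// (ltW C0).
  have h2 : 0 <= h ^+ 2 <= 1 by rewrite sqr_ge0 expr_le1.
  have c2 : 0 <= c1 ^+ 2 <= 1 by rewrite sqr_ge0 expr_le1//; lra.
  have e2 : expR (c1 ^+ 2 * d * h ^+ 2) <= 1 + 2 * (c1 ^+ 2 * d * h ^+ 2).
    by apply: expR_le_1D2x; nra.
  have E : (c1 * h) ^+ 2 = c1 ^+ 2 * h ^+ 2 by rewrite exprMn.
  move: (le_trans e1 e2) (expR_gt0 (c1 ^+ 2 * d * Num.min (h ^+ 2) (h `^ p))).
  move: (expR _) => e he e0.
  have : e <= 1 + (c1 * h) ^+ 2 / 200 by rewrite E; nra.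
  move: (c1 * h) c1h => t c1h; nra.
have hp1 : 1 <= h `^ p by rewrite -(powRr0 h) ler_powR ?ltW.
exists (expR (h `^ p / 2)); split.
- by rewrite -[leLHS]expR0 ler_expR; lra.
- move=> z z0; rewrite expr2 -expRD -splitr mulrC.
  have := tail_shift z0 h0; rewrite /rho ger0_norm// expRN.
  by rewrite ler_pdivlMl ?expR_gt0// mulrC.
- apply: le_trans (@gain_exp d _ (ltW d0) _ _); [|by rewrite dE|by lra].
  rewrite ler_wpM2l ?mulr_ge0 ?expR_ge0// ler_expR.
  have m1 : Num.min (h ^+ 2) (h `^ p) <= h `^ p by rewrite ge_min lexx orbT.
  have c2 : 0 <= c1 ^+ 2 <= 1 by rewrite sqr_ge0 expr_le1//; lra.
  apply: (@le_trans _ _ (c1 ^+ 2 * d * h `^ p)).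
    by rewrite ler_wpM2l// (ltW C0).
  nra.
Qed.

(** The standard deviation of a Bernoulli variable of parameter [cdf_rho x], and
    half the cosine of the coordinate [arc] below. *)
Definition geom_sd (x : R) : R := Num.sqrt (cdf_rho x * tail_rho x).

(** In the coordinate [arc] the right-hand side is
    cos((arc x + arc y) / 2)^2 ([cos_mid_sqr]), while 4 geom_sd(x) geom_sd(y) is
    cos(arc x) cos(arc y): the cosine is log-concave, and the bound quantifies
    the midpoint inequality. *)
Definition two_point_bound (c : R) : Prop := forall x y,
  4 * (geom_sd x * geom_sd y) * expR (c * cost (x - y)) <=
  2 * (geom_sd x * geom_sd y) + cdf_rho x * tail_rho y + cdf_rho y * tail_rho x.

(** For x <= y put a = N(x) U(y) and b = N(y) U(x), so that a <= b.  The product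
    of the two standard deviations is sqrt(a b), the right-hand side of the
    bound is (sqrt a + sqrt b)^2, and their ratio (1 + q)^2 / q increases with
    q = sqrt(b / a) >= 1.  By [odds_growth], q is at least the r of
    [contraction_factor]. *)
Lemma two_point_gain : exists2 c : R, 0 < c & two_point_bound c.
Proof.
have [c c0 H] := contraction_factor.
exists c => //; rewrite /two_point_bound /geom_sd => x y; wlog xy : x y / x <= y.
  move=> W; have [/W//|/ltW/W] := leP x y.
  rewrite /cost distrC (mulrC (Num.sqrt (cdf_rho y * _))).
  by rewrite -!addrA (addrC (cdf_rho y * tail_rho x)).
have h0 : 0 <= (y - x) / 2 by rewrite divr_ge0// subr_ge0.
have [r [r1 rt re]] := H _ h0.
rewrite /cost distrC (ger0_norm (_ : 0 <= y - x)) ?subr_ge0//.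
have N0 z := cdf_gt0 z. have U0 z := tail_gt0 z.
have := odds_growth (sqr_ge0 r) xy rt.
rewrite -sqrtrM; last by rewrite ltW// mulr_gt0.
have -> : cdf_rho x * tail_rho x * (cdf_rho y * tail_rho y) =
  (cdf_rho x * tail_rho y) * (cdf_rho y * tail_rho x) by ring.
have a0 : 0 < cdf_rho x * tail_rho y by rewrite mulr_gt0.
have b0 : 0 < cdf_rho y * tail_rho x by rewrite mulr_gt0.
move: (cdf_rho x * tail_rho y) (cdf_rho y * tail_rho x) a0 b0 => a b a0 b0 rab.
rewrite sqrtrM ?(ltW a0)//.
have A0 : 0 < Num.sqrt a by rewrite sqrtr_gt0.
have B0 : 0 < Num.sqrt b by rewrite sqrtr_gt0.
move: (sqr_sqrtr (ltW a0)) (sqr_sqrtr (ltW b0)) => Ea Eb.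
have AB : r * Num.sqrt a <= Num.sqrt b.
  rewrite -(ger0_norm (ltW (lt_le_trans ltr01 r1))) -sqrtr_sqr -sqrtrM ?sqr_ge0//.
  exact: ler_wsqrtr.
move: (expR _) (expR_gt0 (c * Num.min (((y - x) / 2) ^+ 2) (((y - x) / 2) `^ p))) re.
move: (Num.sqrt a) (Num.sqrt b) Ea Eb A0 B0 AB => A B <- <- A0 B0 AB e e0 re.
have H1 : 0 <= (B - r * A) * (r * B - A).
  by rewrite mulr_ge0 ?subr_ge0//; nra.
rewrite -(ler_pM2l (lt_le_trans ltr01 r1)).
have H2 := ler_wpM2l (ltW (mulr_gt0 A0 B0)) re.
nra.
Qed.

Lemma tailE x : tail_rho x = 1 - cdf_rho x.
Proof. by rewrite -(cdf_tail x) [X in X - _]addrC addrK. Qed.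

(** * The arcsine coordinate *)

Definition arc (x : R) : R := asin (2 * cdf_rho x - 1).

Definition arc_density (x : R) : R := rho x / (Zrho * geom_sd x).

Lemma geom_sd_gt0 x : 0 < geom_sd x.
Proof. by rewrite sqrtr_gt0; exact: mulr_gt0 (cdf_gt0 x) (tail_gt0 x). Qed.

Lemma arc_density_gt0 x : 0 < arc_density x.
Proof. exact: divr_gt0 (rho_gt0 x) (mulr_gt0 Zrho_gt0 (geom_sd_gt0 x)). Qed.

Lemma arc_arg_itv x : -1 < 2 * cdf_rho x - 1 < 1.
Proof. by have := cdf_gt0 x; have := tail_gt0 x; have := cdf_tail x; lra. Qed.

Lemma arc_arg_itvW x : -1 <= 2 * cdf_rho x - 1 <= 1.
Proof. by have /andP[? ?] := arc_arg_itv x; rewrite !ltW. Qed.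

Lemma sin_arc x : sin (arc x) = 2 * cdf_rho x - 1.
Proof. by rewrite /arc asinK// in_itv/= arc_arg_itvW. Qed.

Lemma cos_arc x : cos (arc x) = 2 * geom_sd x.
Proof.
rewrite /arc cos_asin ?arc_arg_itvW// /geom_sd.
rewrite (_ : 1 - _ ^+ 2 = 2 ^+ 2 * (cdf_rho x * tail_rho x)); last first.
  by rewrite tailE; ring.
by rewrite sqrtrM ?sqr_ge0// sqrtr_sqr ger0_norm.
Qed.

Lemma arc_itv x : - (pi / 2) < arc x < pi / 2.
Proof.
have /andP[h1 h2] := arc_arg_itv x.
by rewrite asin_gtNpi2 ?asin_ltpi2// ?h1 ?h2 ltW.
Qed.

Lemma is_derive_arc (x : R) : is_derive x 1 arc (arc_density x).
Proof.
have D1 : is_derive x 1 (fun x => 2 * cdf_rho x - 1) (2 * (rho x / Zrho)).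
  have := is_deriveB (is_deriveZ 2 (is_derive_cdf x)) (is_derive_cst (1 : R) x 1).
  by rewrite subr0.
have D2 := is_derive1_asin (arc_arg_itv x).
have -> : arc_density x = (2 * (rho x / Zrho)) * (Num.sqrt (1 - (2 * cdf_rho x - 1) ^+ 2))^-1.
  rewrite -cos_asin ?arc_arg_itvW// -/(arc x) cos_arc /arc_density.
  have := geom_sd_gt0 x; have := Zrho_gt0; move: (geom_sd x) Zrho => s Z Z0 s0.
  by field; rewrite !gt_eqF.
by rewrite mulrC; exact: (@is_derive1_comp R asin (fun x => 2 * cdf_rho x - 1) x _ _ D2 D1).
Qed.

Lemma continuous_cdf : continuous cdf_rho.
Proof.
move=> x; apply: differentiable_continuous; apply/derivable1_diffP.
by have [] := is_derive_cdf x.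
Qed.

Lemma continuous_arc : continuous arc.
Proof.
move=> x; apply: differentiable_continuous; apply/derivable1_diffP.
by have [] := is_derive_arc x.
Qed.

Lemma continuous_geom_sd : continuous geom_sd.
Proof.
move=> x; apply: continuous_comp; last exact: sqrt_continuous.
apply: continuousM; first exact: continuous_cdf.
have -> : tail_rho = (fun x => 1 - cdf_rho x) by apply/funext => y; rewrite tailE.
by apply: continuousB; [exact: cst_continuous|exact: continuous_cdf].
Qed.

Lemma continuous_arc_density : continuous arc_density.
Proof.
move=> x; apply: continuousM; first exact: continuous_rho.
apply: continuousV; first by rewrite (gt_eqF (mulr_gt0 Zrho_gt0 (geom_sd_gt0 x))).
by apply: continuousM; [exact: cst_continuous|exact: continuous_geom_sd].
Qed.

Lemma measurable_arc_density : measurable_fun [set: R] arc_density.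
Proof. by apply: continuous_measurable_fun; exact: continuous_arc_density. Qed.

Lemma measurable_geom_sd : measurable_fun [set: R] geom_sd.
Proof. by apply: continuous_measurable_fun; exact: continuous_geom_sd. Qed.

Lemma integral_arc_density (a b : R) : a < b ->
  (\int[mu]_(x in `[a, b]) (arc_density x)%:E = (arc b - arc a)%:E)%E.
Proof.
move=> ab; rewrite (@continuous_FTC2 R arc_density arc a b)//.
- exact: continuous_subspaceT continuous_arc_density.
- split.
  + by move=> x _; have [] := is_derive_arc x.
  + exact/cvg_at_right_filter/continuous_arc.
  + exact/cvg_at_left_filter/continuous_arc.
- by move=> x _; rewrite derive1E; have [_] := is_derive_arc x.
Qed.

(** The weight is the derivative of [arc], so an interval carries the increment
    of [arc] along it.  The truncations [An] make the spanned interval bounded;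
    its endpoints are limits of points of A, and by continuity they still
    satisfy the bounds on [arc]. *)
Lemma integral_arc_density_le (A : set R) (I S : R) : measurable A -> I <= S ->
  (forall x, A x -> I <= arc x <= S) ->
  (\int[mu]_(x in A) (arc_density x)%:E <= (S - I)%:E)%E.
Proof.
move=> mA IS H.
have mw D : measurable_fun D (EFin \o arc_density).
  apply: (measurable_funS (E := setT)) => //.
  by apply/measurable_EFinP; exact: measurable_arc_density.
have w0 x : (0 <= (arc_density x)%:E)%E by rewrite lee_fin ltW ?arc_density_gt0.
pose An (n : nat) := A `&` `[- n%:R, n%:R].
have mAn n : measurable (An n) by exact: measurableI.
have AnA : \bigcup_n An n = A.
  rewrite /An -setI_bigcupr [X in _ `&` X](_ : _ = setT) ?setIT//.
  apply/seteqP; split => // x _; exists (Num.bound `|x|) => //=.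
  by rewrite in_itv/= -ler_norml ltW// archi_boundP.
have ndAn : nondecreasing_seq An.
  move=> m n mn; rewrite subsetEset; apply: setIS => x/=.
  by rewrite !in_itv/= -!ler_norml => /le_trans; apply; rewrite ler_nat.
have := ge0_nondecreasing_set_cvg_integral ndAn mAn
  (fun n => mw (An n)) (fun n x _ => w0 x) (mu := mu).
rewrite AnA => cv; rewrite -(cvg_lim _ cv)//.
apply: lime_le; first by apply/cvg_ex; eexists; exact: cv.
near=> n.
have [->|/set0P An0] := eqVneq (An n) set0; first by rewrite integral_set0 lee_fin subr_ge0.
have [x0 Ax0] := An0.
have ub : has_ubound (An n) by exists n%:R => x [_]; rewrite /= in_itv/= => /andP[].
have lb : has_lbound (An n) by exists (- n%:R) => x [_]; rewrite /= in_itv/= => /andP[].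
have hi x : An n x -> x <= sup (An n) by move=> Ax; exact: ub_le_sup.
have lo x : An n x -> inf (An n) <= x by move=> Ax; exact: ge_inf.
have cl (D : set R) : closed D -> arc @` An n `<=` D ->
    arc (sup (An n)) \in D /\ arc (inf (An n)) \in D.
  move=> cD AD; have cAD : closed (arc @^-1` D).
    by apply: closed_comp => // x _; exact: continuous_arc.
  have sub : An n `<=` arc @^-1` D by move=> x Ax; apply: AD; exists x.
  rewrite closure_id in cAD; split; apply/mem_set.
    by have := closureS sub (closure_sup An0 ub); rewrite -cAD.
  have : closure (An n) (inf (An n)).
    move=> U /nbhs_ballP[e e0 eU]; have [x Ax xe] := inf_adherent e0 (conj An0 lb).
    exists x; split => //; apply: eU; rewrite /ball/= distrC ger0_norm ?subr_ge0 ?lo//.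
    by rewrite ltrBlDl.
  by move/(closureS sub); rewrite -cAD.
have sS : arc (sup (An n)) <= S /\ I <= arc (inf (An n)).
  have [] := cl [set y | I <= y <= S].
  - rewrite (_ : [set _ | _] = `[I, S]%classic); first exact: itv_closed.
    by apply/seteqP; split => x /=; rewrite in_itv.
  - by move=> _ [x [Ax _] <-]; exact: H.
  by rewrite !inE => /= /andP[_ ->] /andP[->].
apply: (@le_trans _ _ (\int[mu]_(x in `[inf (An n), sup (An n)]) (arc_density x)%:E)%E).
  apply: ge0_subset_integral;
    [exact: mAn|exact: measurable_itv|exact: mw|by move=> x _; exact: w0|].
  by move=> x Ax; rewrite /= in_itv/= hi// lo.
have [lt_is|si] := ltP (inf (An n)) (sup (An n)).
  by rewrite integral_arc_density// lee_fin lerB//; case: sS.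
have -> : sup (An n) = inf (An n).
  by apply/eqP; rewrite eq_le si (le_trans (lo _ Ax0) (hi _ Ax0)).
by rewrite set_itv1 integral_set1 lee_fin subr_ge0.
Unshelve. all: by end_near. Qed.

(** * The functional inequality on the line *)

Lemma measurable_superlevel (F : R -> R) (s : R) : measurable_fun [set: R] F ->
  measurable [set x | s < F x].
Proof.
move=> mF; rewrite -[X in measurable X]setTI.
have mb : measurable_fun [set: R] (fun t : R => s < F t) by exact: measurable_fun_ltr.
exact: (mb measurableT [set true]).
Qed.

Lemma measurable_cos : measurable_fun [set: R] (@cos R).
Proof. by apply: continuous_measurable_fun; exact: continuous_cos. Qed.

(** This is acos(s) for 0 <= s < 1, and 0 for s >= 1. *)
Definition half_cos_level (s : R) : R :=
  fine (mu [set t | (0 <= t <= pi / 2) && (s < cos t)]).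

Lemma measurable_half_cos_level (s : R) :
  measurable [set t : R | (0 <= t <= pi / 2) && (s < cos t)].
Proof.
rewrite (_ : [set _ | _] = `[0, pi / 2] `&` [set x | s < cos x]).
  apply: measurableI; first exact: measurable_itv.
  by apply: measurable_superlevel; exact: measurable_cos.
by apply/seteqP; split => t /=; rewrite in_itv/=; [move=> /andP[]|move=> [-> ->]].
Qed.

Lemma half_cos_level_fin (s : R) :
  mu [set t | (0 <= t <= pi / 2) && (s < cos t)] = (half_cos_level s)%:E.
Proof.
have sub : [set t | (0 <= t <= pi / 2) && (s < cos t)] `<=` `[0, pi / 2].
  by move=> t /= /andP[]; rewrite in_itv.
have E2 : mu `[0, pi / 2]%classic = (pi / 2 - 0)%:E.
  by rewrite lebesgue_measure_itvcc//; have := @pi_gt0 R; lra.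
have le2 := @le_measure _ _ _ mu _ _ (mem_set (measurable_half_cos_level s))
  (mem_set (measurable_itv _)) sub.
rewrite /half_cos_level fineK//.
by rewrite ge0_fin_numE//; apply: le_lt_trans le2 _; rewrite [ltLHS]E2 ltry.
Qed.

(** If all midpoints (arc x + arc y) / 2 lie in [- T, T], then the suprema of
    [arc] on A and B add up to at most 2 T and the infima to at least - 2 T. *)
Lemma level_arc_measure (A B : set R) (s : R) : measurable A -> measurable B ->
  A !=set0 -> B !=set0 -> 0 <= s ->
  (forall x y, A x -> B y -> s < cos ((arc x + arc y) / 2)) ->
  (\int[mu]_(x in A) (arc_density x)%:E + \int[mu]_(x in B) (arc_density x)%:E
   <= (4 * half_cos_level s)%:E)%E.
Proof.
move=> mA mB [a Aa] [b Bb] s0 H.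
have mid x y : A x -> B y -> `|(arc x + arc y) / 2| <= half_cos_level s.
  move=> Ax By; set m := (_ / 2).
  have ms : s < cos `|m|.
    by have [m0|m0] := leP 0 m; rewrite ?(ger0_norm m0) ?(ltr0_norm m0) ?cosN; exact: H.
  have m_lt : `|m| <= pi / 2.
    have /andP[x1 x2] := arc_itv x; have /andP[y1 y2] := arc_itv y.
    by rewrite ler_norml; apply/andP; split; rewrite /m; lra.
  have pi0 := @pi_gt0 R.
  have sub1 : `[0, `|m|] `<=` [set t | (0 <= t <= pi / 2) && (s < cos t)].
    move=> t /=; rewrite in_itv/= => /andP[t0 tm]; rewrite t0 (le_trans tm m_lt)/=.
    apply: lt_le_trans ms _; rewrite leNgt ltr_cos ?in_itv/= -?leNgt//;
      by apply/andP; split=> //; lra.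
  have E1 := lebesgue_measure_itvcc (normr_ge0 m); rewrite subr0 in E1.
  rewrite -lee_fin -half_cos_level_fin -E1.
  exact: (@le_measure _ _ _ mu _ _ (mem_set (measurable_itv _))
    (mem_set (measurable_half_cos_level s)) sub1).
pose T := half_cos_level s; rewrite -/T in mid *.
have bd x y : A x -> B y -> - (2 * T) <= arc x + arc y <= 2 * T.
  move=> Ax By; have := mid x y Ax By; rewrite ler_norml; lra.
have ubA : has_ubound (arc @` A) by exists (pi / 2) => _ [x _ <-]; have := arc_itv x; lra.
have ubB : has_ubound (arc @` B) by exists (pi / 2) => _ [x _ <-]; have := arc_itv x; lra.
have lbA : has_lbound (arc @` A) by exists (- (pi / 2)) => _ [x _ <-]; have := arc_itv x; lra.
have lbB : has_lbound (arc @` B) by exists (- (pi / 2)) => _ [x _ <-]; have := arc_itv x; lra.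
have HA x : A x -> inf (arc @` A) <= arc x <= sup (arc @` A).
  by move=> Ax; rewrite ge_inf ?ub_le_sup//; exists x.
have HB x : B x -> inf (arc @` B) <= arc x <= sup (arc @` B).
  by move=> Ax; rewrite ge_inf ?ub_le_sup//; exists x.
have nA : arc @` A !=set0 by exists (arc a), a.
have nB : arc @` B !=set0 by exists (arc b), b.
have S2 : sup (arc @` A) <= 2 * T - sup (arc @` B).
  apply: ge_sup => // _ [x Ax <-]; rewrite lerBrDr -lerBrDl.
  by apply: ge_sup => // _ [y By <-]; have := bd x y Ax By; lra.
have I2 : - (2 * T) - inf (arc @` B) <= inf (arc @` A).
  apply: lb_le_inf => // _ [x Ax <-]; rewrite lerBlDr -lerBlDl.
  by apply: lb_le_inf => // _ [y By <-]; have := bd x y Ax By; lra.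
apply: le_trans (leeD (integral_arc_density_le mA _ HA) (integral_arc_density_le mB _ HB)) _.
- by have /andP[] := HA a Aa; exact: le_trans.
- by have /andP[] := HB b Bb; exact: le_trans.
by rewrite -EFinD lee_fin; lra.
Qed.

(** The absolute value only serves to have a function that is non-negative on
    the whole line, as [layer_cake] wants. *)
Lemma half_cos_levelE (s : R) :
  (\int[mu]_(t in [set t | (s < `|cos t|)%R]) (\1_(`[0, pi / 2]%classic) t)%:E
    = (half_cos_level s)%:E)%E.
Proof.
rewrite integral_indic; last exact: measurable_itv; last first.
  by apply: measurable_superlevel; apply: measurableT_comp => //; exact: measurable_cos.
rewrite -half_cos_level_fin; congr (mu _); apply/seteqP; split => t /=; rewrite in_itv/=.
  by move=> [/andP[t0 t1]]; rewrite t0 t1 ger0_norm//; apply: cos_ge0_pihalf; rewrite t1 andbT; lra.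
move=> /andP[/andP[t0 t1]]; rewrite t0 t1 ger0_norm//; apply: cos_ge0_pihalf; rewrite t1 andbT; lra.
Qed.

Lemma integral_half_cos_level :
  (\int[mu]_(s in `[0%R, +oo[) (half_cos_level s)%:E = 1)%E.
Proof.
under eq_integral do rewrite -half_cos_levelE.
rewrite -layer_cake//; last first.
- by apply: measurableT_comp => //; exact: measurable_cos.
have -> : (\int[mu]_t (`|cos t| * \1_(`[0%R, (pi / 2)%R]%classic) t)%:E =
    \int[mu]_(t in `[0%R, (pi / 2)%R]) (cos t)%:E)%E.
  rewrite [RHS]integral_mkcond; apply: eq_integral => t _.
  rewrite patchE indicE mem_setE in_itv/=; case: ifPn => [/andP[t0 t1]|_]; last by rewrite mulr0.
  by rewrite mulr1 ger0_norm//; apply: cos_ge0_pihalf; rewrite t1 andbT; lra.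
have pi0 := @pi_gt0 R.
rewrite (@continuous_FTC2 R cos sin 0 (pi / 2)); first by rewrite sin_pihalf sin0 sube0.
- lra.
- by apply: continuous_subspaceT; exact: continuous_cos.
- split.
  + by move=> x _; have [] := is_derive_sin x.
  + exact/cvg_at_right_filter/continuous_sin.
  + exact/cvg_at_left_filter/continuous_sin.
- by move=> x _; rewrite derive1E; have [_] := is_derive_sin x.
Qed.

(** Layer cake on both sides, level by level with [level_arc_measure], as in
    the proof of the one-dimensional Prekopa-Leindler inequality.  The common
    supremum M ensures that at each level both sets are empty or none is. *)
Lemma prekopa_arc (F G : R -> R) (M : R) :
  measurable_fun [set: R] F -> measurable_fun [set: R] G ->
  (forall x, 0 <= F x <= M) -> (forall x, 0 <= G x <= M) ->
  (forall s, s < M -> exists x, s < F x) ->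
  (forall s, s < M -> exists x, s < G x) ->
  (forall x y, F x * G y <= cos ((arc x + arc y) / 2) ^+ 2) ->
  (\int[mu]_x (F x * arc_density x)%:E + \int[mu]_x (G x * arc_density x)%:E <= 4%:E)%E.
Proof.
move=> mF mG FM GM Fs Gs FG.
have w0 x : 0 <= arc_density x by rewrite ltW ?arc_density_gt0.
have F0 x : 0 <= F x by case/andP: (FM x).
have G0 x : 0 <= G x by case/andP: (GM x).
have mw := measurable_arc_density.
have mlF := measurable_layer mu mF mw w0.
have mlG := measurable_layer mu mG mw w0.
rewrite !layer_cake// -ge0_integralD//; last 4 first.
- by move=> s _; apply: integral_ge0 => x _; rewrite lee_fin.
- exact: measurable_funTS.
- by move=> s _; apply: integral_ge0 => x _; rewrite lee_fin.
- exact: measurable_funTS.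
have hc0 s : 0 <= half_cos_level s by rewrite -lee_fin -half_cos_level_fin measure_ge0.
have mhc : measurable_fun [set: measurableTypeR R] (fun s => (half_cos_level s)%:E).
  under eq_fun do rewrite -half_cos_levelE.
  by apply: measurable_layer => //; apply: measurableT_comp => //; exact: measurable_cos.
have -> : (4%:E = \int[mu]_(s in `[0%R, +oo[) (4%:E * (half_cos_level s)%:E) :> \bar R)%E.
  rewrite ge0_integralZl//; first by rewrite integral_half_cos_level mule1.
  - exact: measurable_funTS.
  - by move=> s _; rewrite lee_fin.
apply: ge0_le_integral; first exact: measurable_itv.
- by move=> s _; rewrite adde_ge0// integral_ge0// => x _; rewrite lee_fin.
- by apply: emeasurable_funD; exact: measurable_funTS.
- by apply: emeasurable_funM; [exact: measurable_cst|exact: measurable_funTS].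
move=> s; rewrite /= in_itv/= andbT => s0.
have [sM|Ms] := ltP s M; last first.
  have e0 (H : R -> R) : (forall x, 0 <= H x <= M) -> [set x | s < H x] = set0.
    move=> HM; apply/seteqP; split => // x /=; apply/negP; rewrite -leNgt.
    by case/andP: (HM x) => _ /le_trans; exact.
  by rewrite !e0// !integral_set0 adde0 -EFinM lee_fin mulr_ge0.
rewrite -EFinM; apply: level_arc_measure => //.
- exact: measurable_superlevel.
- exact: measurable_superlevel.
- by have [x Fx] := Fs s sM; exists x.
- by have [x Gx] := Gs s sM; exists x.
move=> x y /= sF sG.
have c0 : 0 <= cos ((arc x + arc y) / 2).
  by apply: cos_ge0_pihalf; have := arc_itv x; have := arc_itv y; lra.
rewrite -(ltr_pXn2r (n := 2))// ?nnegrE//; apply: lt_le_trans (FG x y).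
by rewrite expr2 ltr_pM.
Qed.

Lemma cos_mid_sqr x y : cos ((arc x + arc y) / 2) ^+ 2 =
  2 * (geom_sd x * geom_sd y) + cdf_rho x * tail_rho y + cdf_rho y * tail_rho x.
Proof.
have := cosD ((arc x + arc y) / 2) ((arc x + arc y) / 2).
rewrite -splitr cosD !cos_arc !sin_arc -!expr2 => H.
have := cos2Dsin2 ((arc x + arc y) / 2).
rewrite !tailE; move: H; move: (cos _) (sin _) => C S; nra.
Qed.

(** [prekopa_arc] for multiples l F and G / l of F = f cos(arc) and
    G = g cos(arc), where l equates the suprema; then u v <= ((u + v) / 2)^2.
    Both suprema are finite because F(x) G(y) <= 1. *)
Lemma infconv_1D (c : R) (f g : R -> R) :
  two_point_bound c ->
  measurable_fun [set: R] f -> measurable_fun [set: R] g ->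
  (forall x, 0 <= f x) -> (forall x, 0 <= g x) ->
  (forall x y, f x * g y <= expR (c * cost (x - y))) ->
  ((\int[mu]_x (f x * rho x)%:E) * (\int[mu]_x (g x * rho x)%:E) <= (Zrho ^+ 2)%:E)%E.
Proof.
move=> gain mf mg f0 g0 fg.
have [[x0 fx0]|f00] := pselect (exists x, 0 < f x); last first.
  rewrite integral0_eq ?mul0e ?lee_fin ?sqr_ge0// => x _.
  have -> : f x = 0; last by rewrite mul0r.
  by apply/eqP; rewrite eq_le f0 andbT leNgt; apply/negP => fx; apply: f00; exists x.
have [[y0 gy0]|g00] := pselect (exists x, 0 < g x); last first.
  rewrite [X in (_ * X)%E]integral0_eq ?mule0 ?lee_fin ?sqr_ge0// => x _.
  have -> : g x = 0; last by rewrite mul0r.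
  by apply/eqP; rewrite eq_le g0 andbT leNgt; apply/negP => fx; apply: g00; exists x.
pose F x := f x * (2 * geom_sd x). pose G x := g x * (2 * geom_sd x).
have sd2 x : 0 < 2 * geom_sd x by rewrite mulr_gt0// geom_sd_gt0.
have F0 x : 0 <= F x by rewrite mulr_ge0// ltW.
have G0 x : 0 <= G x by rewrite mulr_ge0// ltW.
have Fx0 : 0 < F x0 by rewrite mulr_gt0.
have Gy0 : 0 < G y0 by rewrite mulr_gt0.
have FG x y : F x * G y <= cos ((arc x + arc y) / 2) ^+ 2.
  rewrite cos_mid_sqr; apply: le_trans (gain x y).
  rewrite [leLHS](_ : _ = 4 * (geom_sd x * geom_sd y) * (f x * g y)); last by rewrite /F /G; ring.
  by rewrite ler_wpM2l// !mulr_ge0// ltW// geom_sd_gt0.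
have FG1 x y : F x * G y <= 1.
  apply: le_trans (FG x y) _; have := cos2Dsin2 ((arc x + arc y) / 2).
  by have := sqr_ge0 (sin ((arc x + arc y) / 2)); lra.
have ubF : has_ubound (range F).
  by exists (G y0)^-1 => _ [x _ <-]; rewrite -div1r ler_pdivlMr.
have ubG : has_ubound (range G).
  by exists (F x0)^-1 => _ [x _ <-]; rewrite -div1r ler_pdivlMr// mulrC.
pose a := sup (range F); pose b := sup (range G).
have Fa x : F x <= a by apply: ub_le_sup => //; exists x.
have Gb x : G x <= b by apply: ub_le_sup => //; exists x.
have a0 : 0 < a by exact: lt_le_trans Fx0 (Fa _).
have b0 : 0 < b by exact: lt_le_trans Gy0 (Gb _).
have nF : range F !=set0 by exists (F x0), x0.
have nG : range G !=set0 by exists (G x0), x0.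
(* l a = b / l: the rescaled functions have the same supremum. *)
pose l := Num.sqrt (b / a).
have l0 : 0 < l by rewrite sqrtr_gt0 divr_gt0.
have lE : l * a = b / l.
  apply: (mulfI (lt0r_neq0 l0)); rewrite mulrA -expr2 sqr_sqrtr ?divr_ge0 ?ltW//.
  by rewrite divfK ?gt_eqF// mulrCA divff ?mulr1// gt_eqF.
have Z0 := Zrho_gt0.
have sd0 x := geom_sd_gt0 x.
have mF : measurable_fun [set: R] F.
  by apply: measurable_funM => //; apply: measurable_funM => //; exact: measurable_geom_sd.
have mG : measurable_fun [set: R] G.
  by apply: measurable_funM => //; apply: measurable_funM => //; exact: measurable_geom_sd.
have lV0 : 0 < l^-1 by rewrite invr_gt0.
have H : (\int[mu]_x (l * F x * arc_density x)%:E +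
          \int[mu]_x (l^-1 * G x * arc_density x)%:E <= 4%:E)%E.
  apply: (@prekopa_arc _ _ (l * a)).
  - exact: measurable_funM.
  - exact: measurable_funM.
  - by move=> x; rewrite mulr_ge0 ?(ltW l0)//= ler_wpM2l// ltW.
  - by move=> x; rewrite mulr_ge0 ?(ltW lV0)//= lE mulrC ler_wpM2r// ltW.
  - move=> s; rewrite mulrC -ltr_pdivrMr// => sa.
    have [_ [x _ <-] Hx] := sup_gt nF sa.
    by exists x; rewrite mulrC -ltr_pdivrMr.
  - move=> s; rewrite lE ltr_pdivlMr// => sa.
    have [_ [x _ <-] Hx] := sup_gt nG sa.
    by exists x; rewrite mulrC ltr_pdivlMr.
  - move=> x y; apply: le_trans (FG x y).
    by rewrite mulrACA divff ?gt_eqF// mul1r.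
have intE (h : R -> R) k : measurable_fun [set: R] h -> (forall x, 0 <= h x) -> 0 < k ->
  (\int[mu]_x (k * (h x * (2 * geom_sd x)) * arc_density x)%:E =
   (2 * k / Zrho)%:E * \int[mu]_x (h x * rho x)%:E)%E.
  move=> mh h0 k0; rewrite -ge0_integralZl//.
  - apply: eq_integral => x _; rewrite -EFinM; congr EFin; rewrite /arc_density.
    by field; rewrite (gt_eqF Z0) (gt_eqF (sd0 x)).
  - by apply/measurable_EFinP/measurable_funM => //; exact: measurable_rho.
  - by move=> x _; rewrite lee_fin mulr_ge0// rho_ge0.
  - by rewrite lee_fin ltW// divr_gt0// mulr_gt0.
rewrite (intE f l)// (intE g l^-1)// in H.
have If : (0 <= \int[mu]_x (f x * rho x)%:E)%E.
  by apply: integral_ge0 => x _; rewrite lee_fin mulr_ge0// rho_ge0.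
have Ig : (0 <= \int[mu]_x (g x * rho x)%:E)%E.
  by apply: integral_ge0 => x _; rewrite lee_fin mulr_ge0// rho_ge0.
have k1 : 0 < 2 * l / Zrho by rewrite divr_gt0// mulr_gt0.
have k2 : 0 < 2 * l^-1 / Zrho by rewrite divr_gt0// mulr_gt0.
move: If Ig H; move: (integral _ _ _) => I; move: (integral _ _ _) => J.
case: I J => [I| |] [J| |] //=.
- rewrite !lee_fin => I0 J0 H.
  pose u := l * I; pose v := l^-1 * J.
  have uv : u * v = I * J by rewrite /u /v mulrACA divff ?mul1r// gt_eqF.
  have : u + v <= 2 * Zrho.
    rewrite -(ler_pM2l (divr_gt0 (ltr0n _ 2) Z0)).
    have -> : 2 / Zrho * (2 * Zrho) = 4 by field; rewrite gt_eqF.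
    apply: le_trans H; rewrite /u /v le_eqVlt; apply/orP; left; apply/eqP; ring.
  rewrite -uv {uv}; have : 0 <= u by rewrite mulr_ge0// ltW.
  have : 0 <= v by rewrite mulr_ge0// ltW.
  move: (u) (v) (Zrho) => {}u {}v Z v0 u0 uvZ.
  have : (u + v) ^+ 2 <= (2 * Z) ^+ 2 by rewrite ler_pXn2r// nnegrE; lra.
  by have := sqr_ge0 (u - v); nra.
- by move=> _ _; rewrite gt0_muley ?lte_fin// addey// leye_eq.
- by move=> _ _; rewrite gt0_muley ?lte_fin// addye// leye_eq.
- by move=> _ _; rewrite !gt0_muley ?lte_fin// addye// leye_eq.
Qed.

Lemma infconv_1D_ereal (c : R) (f g : R -> \bar R) :
  two_point_bound c ->
  measurable_fun [set: R] f -> measurable_fun [set: R] g ->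
  (forall x, 0 <= f x)%E -> (forall x, 0 <= g x)%E ->
  (forall x y, f x * g y <= (expR (c * cost (x - y)))%:E)%E ->
  ((\int[mu]_x (f x * (rho x)%:E)) * (\int[mu]_x (g x * (rho x)%:E)) <= (Zrho ^+ 2)%:E)%E.
Proof.
move=> gain mf mg f0 g0 fg.
have [[x0 fx0]|f00] := pselect (exists x, 0 < f x)%E; last first.
  rewrite integral0_eq ?mul0e ?lee_fin ?sqr_ge0// => x _.
  have -> : f x = 0%E; last by rewrite mul0e.
  by apply/eqP; rewrite eq_le f0 andbT leNgt; apply/negP => fx; apply: f00; exists x.
have [[y0 gy0]|g00] := pselect (exists x, 0 < g x)%E; last first.
  rewrite [X in (_ * X)%E]integral0_eq ?mule0 ?lee_fin ?sqr_ge0// => x _.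
  have -> : g x = 0%E; last by rewrite mul0e.
  by apply/eqP; rewrite eq_le g0 andbT leNgt; apply/negP => fx; apply: g00; exists x.
have ff x : f x \is a fin_num.
  rewrite ge0_fin_numE// ltey; apply/eqP => fx; have := fg x y0.
  by rewrite fx gt0_mulye// leye_eq.
have gf y : g y \is a fin_num.
  rewrite ge0_fin_numE// ltey; apply/eqP => fx; have := fg x0 y.
  by rewrite fx gt0_muley// leye_eq.
have fE : f = EFin \o (fine \o f) by apply/funext => x /=; rewrite fineK.
have gE : g = EFin \o (fine \o g) by apply/funext => x /=; rewrite fineK.
rewrite fE gE; under eq_integral do rewrite -EFinM.
under [X in (_ * X)%E]eq_integral do rewrite -EFinM.
apply: (infconv_1D gain).
- exact: measurableT_comp.
- exact: measurableT_comp.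
- by move=> x; rewrite /= fine_ge0.
- by move=> x; rewrite /= fine_ge0.
- by move=> x y; rewrite /= -lee_fin EFinM !fineK.
Qed.

(** * Passage to n coordinates *)

Lemma measurable_tnthR n (i : 'I_n) :
  measurable_fun [set: Rvec R n] (fun x : Rvec R n => (tnth x i : R)).
Proof. exact: measurable_tnth. Qed.

Definition norm_powR_sum n (x : Rvec R n) : R := \sum_(i < n) `|tnth x i : R| `^ p.

Definition rhon n (x : Rvec R n) : R := expR (- norm_powR_sum x).

Definition costn n (x y : Rvec R n) : R := \sum_(i < n) cost ((tnth x i : R) - tnth y i).

Lemma measurable_norm_powR : measurable_fun [set: R] (fun x : R => `|x| `^ p).
Proof. by apply: continuous_measurable_fun; exact: continuous_norm_powR. Qed.

Lemma measurable_norm_powR_sum n : measurable_fun [set: Rvec R n] (@norm_powR_sum n).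
Proof.
apply: measurable_sum => i.
by apply: (measurableT_comp measurable_norm_powR); exact: measurable_tnthR.
Qed.

Lemma measurable_rhon n : measurable_fun [set: Rvec R n] (@rhon n).
Proof.
by apply: measurableT_comp => //; apply: measurableT_comp => //; exact: measurable_norm_powR_sum.
Qed.

Lemma rhon_ge0 n (x : Rvec R n) : 0 <= rhon x. Proof. exact: expR_ge0. Qed.

Lemma norm_powR_sum_cons n (a : measurableTypeR R) (v : Rvec R n) :
  norm_powR_sum (Rvec_cons (a, v)) = `|a| `^ p + norm_powR_sum v.
Proof.
by rewrite /norm_powR_sum big_ord_recl/=; congr (_ + _); apply: eq_bigr => i _; rewrite tnthS.
Qed.

Lemma rhon_cons n (a : measurableTypeR R) (v : Rvec R n) :
  rhon (Rvec_cons (a, v)) = rho a * rhon v.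
Proof. by rewrite /rhon norm_powR_sum_cons opprD expRD. Qed.

Lemma costn_cons n (a b : measurableTypeR R) (v w : Rvec R n) :
  costn (Rvec_cons (a, v)) (Rvec_cons (b, w)) = cost ((a : R) - b) + costn v w.
Proof.
by rewrite /costn big_ord_recl/=; congr (_ + _); apply: eq_bigr => i _; rewrite !tnthS.
Qed.

(** Fix first coordinates a and b.  The sections of f and of
    exp(- c cost(a - b)) g satisfy the hypothesis in one dimension less, so the
    partial integrals of f and g, up to the constant, satisfy it on the line. *)
Lemma infconv (c : R) n (f g : Rvec R n -> \bar R) :
  two_point_bound c ->
  measurable_fun [set: Rvec R n] f -> measurable_fun [set: Rvec R n] g ->
  (forall x, 0 <= f x)%E -> (forall x, 0 <= g x)%E ->
  (forall x y, f x * g y <= (expR (c * costn x y))%:E)%E ->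
  ((\int[borel_lebesgue R n]_x (f x * (rhon x)%:E)) *
   (\int[borel_lebesgue R n]_x (g x * (rhon x)%:E)) <= (Zrho ^+ (2 * n))%:E)%E.
Proof.
move=> gain.
elim: n => [|n IH] in f g *; move=> mf mg f0 g0 fg.
  have mr : measurable_fun [set: Rvec R 0] (EFin \o @rhon 0).
    by apply/measurable_EFinP; exact: measurable_rhon.
  rewrite !integral_Rvec0; [|exact: emeasurable_funM..].
  have -> : rhon ([tuple] : Rvec R 0) = 1.
    by rewrite /rhon /norm_powR_sum big_ord0 oppr0 expR0.
  rewrite !mule1 muln0 expr0; apply: le_trans (fg _ _) _.
  by rewrite /costn big_ord0 mulr0 expR0.
have mrn m : measurable_fun [set: Rvec R m] (EFin \o @rhon m).
  by apply/measurable_EFinP; exact: measurable_rhon.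
pose sec (h : Rvec R n.+1 -> \bar R) (a : R) : \bar R :=
  (\int[borel_lebesgue R n]_v (h (Rvec_cons (a : measurableTypeR R, v)) * (rhon v)%:E))%E.
have sec0 h a : (forall x, 0 <= h x)%E -> (0 <= sec h a)%E.
  by move=> h0; apply: integral_ge0 => v _; rewrite mule_ge0// lee_fin rhon_ge0.
have msec h : measurable_fun setT h -> (forall x, 0 <= h x)%E -> measurable_fun [set: R] (sec h).
  move=> mh h0.
  (* The weight of the last n coordinates, as a function of all of them. *)
  pose k (x : Rvec R n.+1) : \bar R := (h x * (rhon ([tuple of behead x] : Rvec R n))%:E)%E.
  have mk : measurable_fun setT k.
    apply: emeasurable_funM => //; apply: (measurableT_comp (mrn n)).
    exact: measurable_behead.
  have k0 x : (0 <= k x)%E by rewrite mule_ge0// lee_fin rhon_ge0.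
  apply: eq_measurable_fun (measurable_section_integral mk k0) => a _.
  apply: eq_integral => v _; rewrite /k; congr (_ * (rhon _)%:E)%E.
  by apply: val_inj.
have intsec h : measurable_fun setT h -> (forall x, 0 <= h x)%E ->
  (\int[borel_lebesgue R n.+1]_x (h x * (rhon x)%:E) = \int[mu]_a (sec h a * (rho a)%:E))%E.
  move=> mh h0; rewrite integral_Rvec_cons; last 2 first.
  - by apply: emeasurable_funM => //; exact: mrn.
  - by move=> x; rewrite mule_ge0// lee_fin rhon_ge0.
  apply: eq_integral => a _; rewrite muleC -ge0_integralZl//; last 3 first.
  - by apply: emeasurable_funM; [exact: measurable_Rvec_section|exact: mrn].
  - by move=> v _; rewrite mule_ge0// lee_fin rhon_ge0.
  - by rewrite lee_fin rho_ge0.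
  by apply: eq_integral => v _; rewrite rhon_cons EFinM muleCA.
have Zn0 : 0 < Zrho ^+ (2 * n) by rewrite exprn_gt0// Zrho_gt0.
rewrite !intsec//.
have fgsec a b : (sec f a * sec g b <= (Zrho ^+ (2 * n) * expR (c * cost (a - b)))%:E)%E.
  pose e := expR (c * cost (a - b)); have e0 : 0 < e by exact: expR_gt0.
  have := IH (fun v => f (Rvec_cons (a, v))) (fun v => (e^-1)%:E * g (Rvec_cons (b, v)))%E.
  have -> : (\int[borel_lebesgue R n]_x ((e^-1)%:E * g (Rvec_cons (b, x)) * (rhon x)%:E) =
      (e^-1)%:E * sec g b)%E.
    rewrite -ge0_integralZl//.
    - by apply: eq_integral => v _; rewrite muleA.
    - by apply: emeasurable_funM; [exact: measurable_Rvec_section|exact: mrn].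
    - by move=> v _; rewrite mule_ge0// lee_fin rhon_ge0.
    - by rewrite lee_fin invr_ge0 ltW.
  rewrite -/(sec f a) => H.
  have : (sec f a * ((e^-1)%:E * sec g b) <= (Zrho ^+ (2 * n))%:E)%E.
    apply: H.
    - exact: measurable_Rvec_section.
    - by apply: emeasurable_funM => //; exact: measurable_Rvec_section.
    - by move=> v; exact: f0.
    - by move=> v; rewrite mule_ge0// lee_fin invr_ge0 ltW.
    - move=> v w; rewrite muleCA.
      have := fg (Rvec_cons (a, v)) (Rvec_cons (b, w)).
      rewrite costn_cons mulrDr expRD EFinM => H1.
      have := lee_wpmul2l (_ : 0 <= (e^-1)%:E)%E H1.
      rewrite lee_fin invr_ge0 (ltW e0) => /(_ isT) /le_trans; apply.
      by rewrite -!EFinM mulrA mulVf ?gt_eqF// mul1r.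
  rewrite muleCA lee_pdivrMl ?lte_fin// => /le_trans; apply.
  by rewrite -EFinM mulrC.
have := @infconv_1D_ereal c (fun a => (Zrho ^+ (2 * n))^-1%:E * sec f a)%E (sec g) gain.
have ZV : (0 <= (Zrho ^+ (2 * n))^-1%:E)%E by rewrite lee_fin invr_ge0 ltW.
have -> : (\int[mu]_x ((Zrho ^- (2 * n))%:E * sec f x * (rho x)%:E) =
           (Zrho ^- (2 * n))%:E * \int[mu]_x (sec f x * (rho x)%:E))%E.
  rewrite -ge0_integralZl//.
  - by apply: eq_integral => v _; rewrite muleA.
  - by apply: emeasurable_funM; [exact: msec|exact: measurable_Erho].
  - by move=> v _; rewrite mule_ge0 ?sec0// lee_fin rho_ge0.
move=> H.
have : ((Zrho ^- (2 * n))%:E * \int[mu]_x (sec f x * (rho x)%:E) *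
   (\int[mu]_x (sec g x * (rho x)%:E)) <= (Zrho ^+ 2)%:E)%E.
  apply: H.
  - by apply: emeasurable_funM => //; exact: msec.
  - exact: msec.
  - by move=> a; rewrite mule_ge0// sec0.
  - by move=> a; rewrite sec0.
  - move=> a b; rewrite -muleA lee_pdivrMl ?lte_fin//.
rewrite -muleA lee_pdivrMl ?lte_fin// => /le_trans; apply.
by rewrite -EFinM -exprD mulnS addnC.
Qed.

Lemma mass_rhon n : (\int[borel_lebesgue R n]_x (rhon x)%:E = (Zrho ^+ n)%:E)%E.
Proof.
have mr m : measurable_fun [set: Rvec R m] (EFin \o @rhon m).
  by apply/measurable_EFinP; exact: measurable_rhon.
elim: n => [|n IH].
  by rewrite integral_Rvec0// /rhon /norm_powR_sum big_ord0 oppr0 expR0.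
rewrite integral_Rvec_cons//; last by move=> x; rewrite lee_fin rhon_ge0.
transitivity (\int[mu]_a ((rho a)%:E * (Zrho ^+ n)%:E))%E.
  apply: eq_integral => a _; rewrite -IH -ge0_integralZl//.
  - by apply: eq_integral => v _; rewrite rhon_cons EFinM.
  - exact: mr.
  - by move=> x _; rewrite lee_fin rhon_ge0.
  - by rewrite lee_fin rho_ge0.
rewrite ge0_integralZr//; last 3 first.
- exact: measurable_Erho.
- by move=> x _; rewrite lee_fin rho_ge0.
- by rewrite lee_fin exprn_ge0// ltW// Zrho_gt0.
by rewrite integral_rhoE -EFinM exprS.
Qed.

(** * Concentration of the product measure *)

Definition sqr_norm n (x : Rvec R n) : R := \sum_(i < n) (tnth x i : R) ^+ 2.

Lemma sqr_norm_cons n (a : measurableTypeR R) (v : Rvec R n) :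
  sqr_norm (Rvec_cons (a, v)) = (a : R) ^+ 2 + sqr_norm v.
Proof.
by rewrite /sqr_norm big_ord_recl/=; congr (_ + _); apply: eq_bigr => i _; rewrite tnthS.
Qed.

Lemma measurable_sqr_norm n : measurable_fun [set: Rvec R n] (@sqr_norm n).
Proof.
apply: measurable_sum => i; apply: measurable_funX; exact: measurable_tnthR.
Qed.

Lemma measurable_sqr_norm_ge n (b : R) :
  measurable [set x : Rvec R n | b <= sqr_norm x].
Proof.
rewrite -[X in measurable X]setTI.
have mb : measurable_fun [set: Rvec R n] (fun x : Rvec R n => b <= sqr_norm x).
  by apply: measurable_fun_ler => //; exact: measurable_sqr_norm.
exact: (mb measurableT [set true]).
Qed.

Lemma sqr_norm_ge0 n (x : Rvec R n) : 0 <= sqr_norm x.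
Proof. by apply: sumr_ge0 => i _; rewrite sqr_ge0. Qed.

Lemma second_moment_rho : exists2 V : R, 0 <= V &
  (\int[mu]_x (x ^+ 2 * rho x)%:E <= V%:E)%E.
Proof.
have mx2 : measurable_fun [set: R] (fun x : R => x ^+ 2 * rho x).
  by apply: measurable_funM; [exact: measurable_funX|exact: measurable_rho].
have fin : (\int[mu]_x (x ^+ 2 * rho x)%:E < +oo)%E.
  apply: (@le_lt_trans _ _ (\int[mu]_x ((16 * expR 1)%:E * (expR (- (`|x| / 2)))%:E))%E).
    apply: ge0_le_integral => //.
    - by move=> x _; rewrite lee_fin mulr_ge0 ?sqr_ge0 ?rho_ge0.
    - exact/measurable_EFinP.
    - by apply: emeasurable_funM => //; apply/measurable_EFinP; exact: measurable_expR_norm.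
    - move=> x _; rewrite -EFinM lee_fin.
      have h1 : (`|x| / 4) ^+ 2 <= expR (`|x| / 2).
        rewrite (_ : `|x| / 2 = `|x| / 4 + `|x| / 4); last by field.
        rewrite expRD -expr2 ler_pXn2r ?nnegrE ?expR_ge0 ?divr_ge0//.
        by apply: le_trans (expR_ge1Dx _); rewrite lerDr.
      have h2 : rho x <= expR 1 * expR (- `|x|).
        by rewrite -expRD ler_expR; have := le_norm_powR x; lra.
      have h3 : expR (`|x| / 2) * expR (- `|x|) = expR (- (`|x| / 2)).
        by rewrite -expRD; congr expR; field.
      rewrite -h3 -real_normK ?num_real//.
      have h4 : `|x| ^+ 2 = 16 * (`|x| / 4) ^+ 2 by field.
      rewrite h4; have := ler_pM (sqr_ge0 _) (rho_ge0 x) h1 h2; lra.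
  rewrite ge0_integralZl//.
  - by apply: lte_mul_pinfty => //; exact: integral_expR_norm_lty.
  - by apply/measurable_EFinP; exact: measurable_expR_norm.
have i0 : (0 <= \int[mu]_x (x ^+ 2 * rho x)%:E)%E.
  by apply: integral_ge0 => x _; rewrite lee_fin mulr_ge0 ?sqr_ge0 ?rho_ge0.
exists (fine (\int[mu]_x (x ^+ 2 * rho x)%:E)); first by rewrite fine_ge0.
by rewrite fineK// ge0_fin_numE.
Qed.

Lemma second_moment_rhon : exists2 V : R, 0 <= V & forall n,
  (\int[borel_lebesgue R n]_x (sqr_norm x * rhon x)%:E <= (n%:R * V * Zrho ^+ n)%:E)%E.
Proof.
have [V V0 HV] := second_moment_rho; have Z0 := Zrho_gt0.
exists (V / Zrho); first by rewrite divr_ge0// ltW.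
have mq m : measurable_fun [set: Rvec R m] (fun x : Rvec R m => (sqr_norm x * rhon x)%:E).
  by apply/measurable_EFinP/measurable_funM; [exact: measurable_sqr_norm|exact: measurable_rhon].
have mr m : measurable_fun [set: Rvec R m] (EFin \o @rhon m).
  by apply/measurable_EFinP; exact: measurable_rhon.
have q0 m (x : Rvec R m) : (0 <= (sqr_norm x * rhon x)%:E)%E.
  by rewrite lee_fin mulr_ge0 ?sqr_norm_ge0 ?rhon_ge0.
elim=> [|n IH].
  by rewrite integral_Rvec0// /sqr_norm big_ord0 !mul0r.
rewrite integral_Rvec_cons//.
have mx2 : measurable_fun [set: R] (fun x : R => x ^+ 2 * rho x).
  by apply: measurable_funM; [exact: measurable_funX|exact: measurable_rho].
pose K := n%:R * (V / Zrho) * Zrho ^+ n; rewrite -/K in IH.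
have K0 : 0 <= K by rewrite !mulr_ge0 ?exprn_ge0 ?invr_ge0 ?(ltW Z0).
apply: (@le_trans _ _ (\int[mu]_a ((Zrho ^+ n)%:E * (a ^+ 2 * rho a)%:E + K%:E * (rho a)%:E))%E).
  apply: ge0_le_integral => //.
  - by move=> a _; apply: integral_ge0.
  - exact: (measurable_section_integral (mq n.+1) (q0 n.+1)).
  - by apply: emeasurable_funD; apply: emeasurable_funM => //;
      [exact/measurable_EFinP|exact: measurable_Erho].
  move=> a _.
  have -> : (\int[borel_lebesgue R n]_v (sqr_norm (Rvec_cons (a, v)) * rhon (Rvec_cons (a, v)))%:E =
    (a ^+ 2 * rho a)%:E * (Zrho ^+ n)%:E +
    (rho a)%:E * \int[borel_lebesgue R n]_v (sqr_norm v * rhon v)%:E)%E.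
    have rn0 (v : Rvec R n) : (0 <= (rhon v)%:E :> \bar R)%E by rewrite lee_fin rhon_ge0.
    have E1 : ((a ^+ 2 * rho a)%:E * (Zrho ^+ n)%:E =
        \int[borel_lebesgue R n]_v ((a ^+ 2 * rho a)%:E * (rhon v)%:E))%E.
      rewrite ge0_integralZl ?mass_rhon//; first exact: mr.
      by rewrite lee_fin mulr_ge0 ?rho_ge0// sqr_ge0.
    have E2 : ((rho a)%:E * \int[borel_lebesgue R n]_v (sqr_norm v * rhon v)%:E =
        \int[borel_lebesgue R n]_v ((rho a)%:E * (sqr_norm v * rhon v)%:E))%E.
      by rewrite ge0_integralZl//; [exact: mq|rewrite lee_fin rho_ge0].
    rewrite E1 E2.
    rewrite -ge0_integralD//.
    - apply: eq_integral => v _; rewrite -!EFinM -EFinD; congr EFin.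
      by rewrite rhon_cons sqr_norm_cons; ring.
    - by move=> v _; rewrite mule_ge0// lee_fin mulr_ge0 ?rho_ge0 ?sqr_ge0.
    - by apply: emeasurable_funM => //; exact: mr.
    - by move=> v _; rewrite mule_ge0// lee_fin rho_ge0.
    - by apply: emeasurable_funM => //; exact: mq.
  rewrite muleC leeD2l// muleC lee_wpmul2r// lee_fin rho_ge0//.
rewrite ge0_integralD//; last 4 first.
- move=> x _; rewrite -EFinM lee_fin mulr_ge0 ?exprn_ge0 ?(ltW Z0)//.
  by rewrite mulr_ge0 ?rho_ge0 ?sqr_ge0.
- by apply: emeasurable_funM => //; exact/measurable_EFinP.
- by move=> x _; rewrite -EFinM lee_fin mulr_ge0 ?rho_ge0.
- by apply: emeasurable_funM => //; exact: measurable_Erho.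
rewrite ge0_integralZl//; last 3 first.
- exact/measurable_EFinP.
- by move=> x _; rewrite lee_fin mulr_ge0 ?sqr_ge0 ?rho_ge0.
- by rewrite lee_fin exprn_ge0// ltW.
rewrite ge0_integralZl//; last 2 first.
- exact: measurable_Erho.
- by move=> x _; rewrite lee_fin rho_ge0.
rewrite integral_rhoE.
apply: (@le_trans _ _ ((Zrho ^+ n)%:E * V%:E + K%:E * Zrho%:E)%E).
  by rewrite leeD2r// lee_wpmul2l// lee_fin exprn_ge0// ltW.
rewrite -!EFinM -EFinD lee_fin /K le_eqVlt; apply/orP; left; apply/eqP.
by rewrite exprS -natr1; field; rewrite gt_eqF.
Qed.

(** Let h_i = |x_i - y_i| / 2.  If the total cost were below (D/2)^p, each h_i
    would be at most D/2, or would have cost h_i^2; in both cases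
    h_i^2 <= cost_i (D/2)^(2 - p), as D/2 >= 1 and p <= 2.  The sum over i
    contradicts the assumption. *)
Lemma euclidean_cost_ge n (x y : Rvec R n) (D : R) : p <= 2 -> 2 <= D ->
  D <= euclidean_dist x y -> (D / 2) `^ p <= costn x y.
Proof.
move=> p2 D2 Dxy; set S := costn x y; rewrite leNgt; apply/negP => SD.
have D1 : 1 <= D / 2 by lra.
have D0 : 0 < D / 2 by lra.
have cost_ge0 s : 0 <= cost s by rewrite /cost le_min sqr_ge0 powR_ge0.
pose h i := `|(tnth x i : R) - tnth y i| / 2.
have h0 i : 0 <= h i by rewrite divr_ge0.
have Dsum : (D / 2) ^+ 2 <= \sum_(i < n) h i ^+ 2.
  have -> : \sum_(i < n) h i ^+ 2 = (\sum_(i < n) ((tnth x i : R) - tnth y i) ^+ 2) / 4.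
    rewrite mulr_suml; apply: eq_bigr => i _.
    by rewrite /h expr_div_n real_normK ?num_real// -natrX.
  have s0 : 0 <= \sum_(i < n) ((tnth x i : R) - tnth y i) ^+ 2.
    by apply: sumr_ge0 => i _; rewrite sqr_ge0.
  have : D ^+ 2 <= \sum_(i < n) ((tnth x i : R) - tnth y i) ^+ 2.
    rewrite -(sqr_sqrtr s0) ler_pXn2r ?nnegrE ?sqrtr_ge0//; lra.
  by lra.
have kS i : cost ((tnth x i : R) - tnth y i) <= S.
  rewrite /S /costn (bigD1 i)//= lerDl; apply: sumr_ge0 => j _; exact: cost_ge0.
have hle i : h i ^+ 2 <= cost ((tnth x i : R) - tnth y i) * (D / 2) `^ (2 - p).
  have Dp1 : 1 <= (D / 2) `^ (2 - p).
    by rewrite -[leLHS](powRr0 (D / 2)) ler_powR// subr_ge0.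
  have := kS i; rewrite /cost -/(h i).
  have [hle|hlt] := leP (h i ^+ 2) (h i `^ p) => kSi.
    by rewrite ler_peMr// sqr_ge0.
  have hi0 : 0 < h i.
    rewrite lt_neqAle h0 andbT eq_sym; apply/eqP => hi0.
    by move: hlt; rewrite hi0 powR0 ?gt_eqF// expr0n ltxx.
  have hD : h i <= D / 2.
    rewrite leNgt; apply/negP => Dh.
    have := lt_trans (le_lt_trans kSi SD) (gt0_ltr_powR p0 _ _ Dh).
    by rewrite !nnegrE ltxx => /(_ _ _)/negP; apply; rewrite ?h0 ?(ltW D0).
  have -> : h i ^+ 2 = h i `^ p * h i `^ (2 - p).
    rewrite -powRD; last by rewrite (gt_eqF hi0) implybT.
    by rewrite addrC subrK powR_mulrn.
  rewrite ler_wpM2l ?powR_ge0// ge0_ler_powR ?nnegrE ?subr_ge0//; exact: ltW.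
have : (D / 2) ^+ 2 <= S * (D / 2) `^ (2 - p).
  by apply: le_trans Dsum _; rewrite /S /costn mulr_suml; apply: ler_sum => i _.
apply/negP; rewrite -ltNge.
have -> : (D / 2) ^+ 2 = (D / 2) `^ p * (D / 2) `^ (2 - p).
  rewrite -powRD; last by rewrite (gt_eqF D0) implybT.
  by rewrite addrC subrK powR_mulrn// ltW.
by rewrite ltr_pM2r// powR_gt0.
Qed.

(** The functional inequality for f = 1_A and g = exp(c (D/2)^p) 1_B. *)
Lemma concentration (c : R) n (A B : set (Rvec R n)) (D : R) :
  two_point_bound c ->
  0 <= c -> p <= 2 -> 2 <= D -> measurable A -> measurable B ->
  (forall x y, A x -> B y -> D <= euclidean_dist x y) ->
  ((\int[borel_lebesgue R n]_(x in A) (rhon x)%:E) *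
   (\int[borel_lebesgue R n]_(x in B) (rhon x)%:E) <=
   (Zrho ^+ (2 * n) * expR (- (c * (D / 2) `^ p)))%:E)%E.
Proof.
move=> gain c0 p2 D2 mA mB AB.
pose e := expR (c * (D / 2) `^ p); have e0 : 0 < e by exact: expR_gt0.
have mE X : measurable X -> measurable_fun [set: Rvec R n] (fun x => (\1_X x)%:E : \bar R).
  by move=> mX; apply/measurable_EFinP.
have := @infconv c n (fun x => (\1_A x)%:E) (fun x => e%:E * (\1_B x)%:E)%E gain (mE A mA).
have iE X : measurable X -> (\int[borel_lebesgue R n]_x ((\1_X x)%:E * (rhon x)%:E) =
    \int[borel_lebesgue R n]_(x in X) (rhon x)%:E)%E.
  move=> mX; rewrite [RHS]integral_mkcond; apply: eq_integral => x _.
  by rewrite epatch_indic/= muleC.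
have mr : measurable_fun [set: Rvec R n] (EFin \o @rhon n).
  by apply/measurable_EFinP; exact: measurable_rhon.
rewrite iE//.
have -> : (\int[borel_lebesgue R n]_x (e%:E * (\1_B x)%:E * (rhon x)%:E) =
    e%:E * \int[borel_lebesgue R n]_(x in B) (rhon x)%:E)%E.
  rewrite -iE// -ge0_integralZl//.
  - by apply: eq_integral => x _; rewrite muleA.
  - by apply: emeasurable_funM => //; exact: mE.
  - by move=> x _; rewrite mule_ge0 ?lee_fin ?rhon_ge0.
  - by rewrite lee_fin ltW.
move=> H.
have {}H : ((\int[borel_lebesgue R n]_(x in A) (rhon x)%:E) *
   (e%:E * \int[borel_lebesgue R n]_(x in B) (rhon x)%:E) <= (Zrho ^+ (2 * n))%:E)%E.
  apply: H.
  - by apply: emeasurable_funM => //; exact: mE.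
  - by move=> x; rewrite lee_fin.
  - by move=> x; rewrite mule_ge0 ?lee_fin ?(ltW e0).
  move=> x y; rewrite -!EFinM lee_fin !indicE.
  have [xA|] := boolP (x \in A); last by rewrite mul0r expR_ge0.
  have [yB|] := boolP (y \in B); last by rewrite !mulr0 expR_ge0.
  rewrite !mulr1 mul1r ler_expR ler_wpM2l//; apply: euclidean_cost_ge => //.
  by apply: AB; exact/set_mem.
by rewrite expRN -/e mulrC EFinM lee_pdivlMl// -muleCA.
Qed.

(** * From the ball to the product measure *)

Lemma integral_exp_tail (b : R) : (\int[mu]_(t in `]b, +oo[) (expR (- t))%:E = (expR (- b))%:E)%E.
Proof.
have mE (D : set R) : measurable_fun D (fun t : R => (expR (- t))%:E).
  apply: (measurable_funS (E := setT)) => //; apply/measurable_EFinP.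
  exact: measurableT_comp.
have -> : (`]b, +oo[ = `](0 + b), +oo[ :> set R)%classic by rewrite add0r.
rewrite ge0_integral_tail_shift//.
transitivity (\int[mu]_(t in `]0%R, +oo[) ((expR (- b))%:E * (expR (- t))%:E))%E.
  by apply: eq_integral => t _; rewrite -EFinM -expRD opprD addrC.
rewrite ge0_integralZl; [|exact: measurable_itv|exact: mE
  |by move=> t _; rewrite lee_fin expR_ge0|by rewrite lee_fin expR_ge0].
rewrite (_ : (\int[mu]_(t in `]0%R, +oo[) _ = 1)%E) ?mule1//.
rewrite -[RHS](integral_exponential_pdf ltr01) integral_itv_obnd_cbnd// integral_mkcond.
apply: eq_integral => t _; rewrite patchE mem_setE in_itv/= andbT; case: ifPn => t0.
  by rewrite exponential_pdfE// mul1r mulN1r.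
by rewrite lt0_exponential_pdf// ltNge.
Qed.

(** The substitution t = x^p, as the layer cake formula for the function
    t^(1/p) and the weight exp(- t) on [0, +oo[. *)
Lemma Zrho_Gamma : Zrho = 2 * Gamma (1 + p^-1).
Proof.
have pV0 : 0 < p^-1 by rewrite invr_gt0.
apply: EFin_inj; rewrite -integral_rhoE EFinM -gamma_integralE//.
rewrite ge0_symfun_integralT; first last.
- by move=> x; rewrite /= rhoN.
- exact: continuous_rho.
- exact: rho_ge0.
congr (_ * _)%E.
(* The power of a negative number is 1 by convention, hence the maximum. *)
pose F (t : R) := (Num.max t 0) `^ p^-1.
pose w (t : R) := expR (- t) * \1_(`]0, +oo[%classic : set R) t.
have mF : measurable_fun [set: R] F.
  by apply: (measurableT_comp (measurable_powR _)); exact: measurable_maxr.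
have mw : measurable_fun [set: R] w.
  by apply: measurable_funM; [exact: measurableT_comp|exact: measurable_indic].
transitivity (\int[mu]_t (F t * w t)%:E)%E; last first.
  rewrite [RHS]integral_mkcond; apply: eq_integral => t _.
  rewrite patchE /w indicE mem_setE in_itv/= andbT; case: ifPn => t0; last by rewrite !mulr0.
  by rewrite mulr1 mul1r /F (max_idPl (ltW t0)).
rewrite layer_cake//; last 2 first.
- by move=> t; rewrite powR_ge0.
- by move=> t; rewrite mulr_ge0 ?expR_ge0.
rewrite -set_itvcy; apply: eq_integral => s; rewrite inE/= in_itv/= andbT => s0.
rewrite /rho -integral_exp_tail [LHS]integral_mkcond [RHS]integral_mkcond.
apply: eq_integral => t _.
rewrite ger0_norm//.
have E : (s < F t) = (s `^ p < t).
  rewrite /F; have [t0|t0] := ltP t 0.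
    rewrite powR0 ?gt_eqF// [LHS]ltNge s0/=.
    by apply/esym/negbTE; rewrite -leNgt (le_trans (ltW t0)) ?powR_ge0.
  have tE : (t `^ p^-1) `^ p = t by rewrite -powRrM mulVf ?gt_eqF// powRr1.
  rewrite -[in RHS]tE.
  move: (t `^ p^-1) (powR_ge0 t p^-1) => u u0.
  apply/idP/idP => [|]; first by move/(gt0_ltr_powR p0 _ _); apply; rewrite nnegrE.
  by rewrite !ltNge; apply: contra => us; rewrite ge0_ler_powR ?nnegrE// ltW.
rewrite !patchE mem_setE in_itv/= andbT.
case: ifPn => st; last first.
  by rewrite memNset//= E; apply/negP.
rewrite mem_set/= ?E// /w indicE mem_set ?mulr1//= in_itv/= andbT.
by apply: le_lt_trans st; exact: powR_ge0.
Qed.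

(** Consider the pairs (g, t) with t in [lo, hi] whose rescaled point
    om t^(-1/p) g is in A, with the weight exp(- t).  For fixed t the section is
    a dilate of A, of volume (om t^(-1/p))^(-n) vol(A).  For fixed g, the point
    can only be in the ball if |g_1|^p + ... + |g_n|^p <= t, so the weight of
    the section is at most the tail of exp(- t) from there on, which is
    [rhon g].  The set At collects the g with a section of positive weight. *)
Lemma lift_set n (om lo hi : R) (A : set (Rvec R n)) : 0 < om -> 0 < lo ->
  measurable A -> A `<=` dilate om (lp_ball p n) ->
  exists At : set (Rvec R n), [/\ measurable At,
    (forall g, At g -> exists2 t, lo <= t <= hi & A (map_tuple ( *%R (om * t `^ (- p^-1))) g)) &
    (borel_lebesgue R n A * (om ^- n)%:E *
       \int[mu]_(t in `[lo, hi]) (t `^ (n%:R / p) * expR (- t))%:E <=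
     \int[borel_lebesgue R n]_(x in At) (rhon x)%:E)%E].
Proof.
move=> om0 lo0 mA AK.
pose s (t : R) := om * t `^ (- p^-1).
pose W : set R := `[lo, hi]%classic.
pose h (z : Rvec R n * measurableTypeR R) : \bar R :=
  (\1_A (map_tuple ( *%R (s z.2)) z.1) * (expR (- (z.2 : R)) * \1_W z.2))%:E.
have ms : measurable_fun [set: R] s.
  by apply: measurable_funM => //; exact: measurable_powR.
have m1 : measurable_fun setT (fun z : Rvec R n * measurableTypeR R =>
    map_tuple ( *%R (s z.2)) z.1 : Rvec R n).
  have m2 : measurable_fun setT (fun z : Rvec R n * measurableTypeR R =>
      (s z.2 : measurableTypeR R, z.1)).
    by apply/measurable_fun_pairP; split; [exact: (measurableT_comp ms)|exact: measurable_fst].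
  exact: (measurableT_comp (@measurable_scale R n) m2).
have mA1 : measurable_fun setT (\1_A : Rvec R n -> R) by exact: measurable_indic.
have mW1 : measurable_fun setT (\1_W : measurableTypeR R -> R).
  by apply: measurable_indic; exact: measurable_itv.
have me : measurable_fun [set: measurableTypeR R]
    (fun t : measurableTypeR R => expR (- (t : R)) * \1_W t).
  by apply: measurable_funM => //; exact: measurableT_comp.
have mh : measurable_fun setT h.
  apply/measurable_EFinP; apply: measurable_funM; first exact: (measurableT_comp mA1 m1).
  exact: (measurableT_comp me).
have h0 z : (0 <= h z)%E by rewrite lee_fin !mulr_ge0 ?expR_ge0.
pose k (g : Rvec R n) : \bar R := (\int[mu]_t h (g, t))%E.
have mk : measurable_fun setT k by exact: measurable_fun_fubini_tonelli_F.
have k0 g : (0 <= k g)%E by exact: integral_ge0.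
pose At := [set g | (0 < k g)%E].
have mAt : measurable At.
  rewrite -[X in measurable X]setTI; exact: emeasurable_fun_o_infty.
exists At; split => //.
- move=> g; rewrite /At/= => kg; apply: contrapT => H.
  move: kg; rewrite [k g]integral0_eq ?ltxx// => t _; rewrite /h/=.
  congr EFin; have [tW|tW] := boolP (t \in W); last first.
    by rewrite [X in _ * (_ * X)]indicE (negbTE tW) !mulr0.
  rewrite indicE memNset ?mul0r// => At'; apply: H; exists t => //.
  by move: tW; rewrite inE /W/= in_itv.
have klt g : (k g <= ((EFin \o @rhon n) \_ At) g)%E.
  rewrite patchE; case: ifPn => [gA|/negP gA]; last first.
    by rewrite leNgt; apply/negP => kg; apply: gA; rewrite inE.
  have mE (D : set R) : measurable_fun D (fun t : R => (expR (- t))%:E).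
    apply: (measurable_funS (E := setT)) => //; apply/measurable_EFinP.
    exact: measurableT_comp.
  rewrite /= /rhon -integral_exp_tail integral_itv_obnd_cbnd; last exact: mE.
  rewrite [leRHS]integral_mkcond; apply: ge0_le_integral => //.
  - by apply: (measurableT_comp mh); exact: measurable_pair1.
  - by apply/(measurable_restrictT _ _).1; [exact: measurable_itv|exact: mE].
  move=> t _; rewrite patchE mem_setE in_itv/= andbT; case: ifPn => Nt.
    rewrite lee_fin !indicE; move: (_ \in A) (_ \in W) => [] [];
    by rewrite ?mul0r ?mul1r ?mulr0 ?mulr1 ?lexx ?expR_ge0.
  have -> : h (g, t) = 0%E; last by [].
  rewrite /h/=; congr EFin.
  have [tW|tW] := boolP (t \in W); last by rewrite [X in _ * (_ * X)]indicE (negbTE tW) !mulr0.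
  rewrite indicE memNset ?mul0r// => /AK[y yK yE]; apply: (negP Nt).
  have t0 : 0 < t by move: tW; rewrite inE /W/= in_itv/= => /andP[/(lt_le_trans lo0)].
  have ti : 0 < t `^ (- p^-1) by rewrite powR_gt0.
  have yi i : (tnth y i : R) = t `^ (- p^-1) * tnth g i.
    have := congr1 (fun z => tnth z i) yE; rewrite !tnth_map /s -mulrA.
    by move/(mulfI (lt0r_neq0 om0)).
  move: yK; rewrite /lp_ball/=.
  have -> : \sum_(i < n) `|tnth y i : R| `^ p = t^-1 * norm_powR_sum g.
    rewrite /norm_powR_sum mulr_sumr; apply: eq_bigr => i _.
    rewrite yi normrM powRM ?normr_ge0// (ger0_norm (ltW ti)); congr (_ * _).
    by rewrite -powRrM mulNr mulVf ?gt_eqF// powRN powRr1// ltW.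
  by rewrite -[leRHS](mulVf (lt0r_neq0 t0)) ler_pM2l ?invr_gt0.
have mr : measurable_fun [set: Rvec R n] (EFin \o @rhon n).
  by apply/measurable_EFinP; exact: measurable_rhon.
rewrite [leRHS]integral_mkcond.
apply: (@le_trans _ _ (\int[borel_lebesgue R n]_g k g)%E); last first.
  apply: ge0_le_integral => //.
  by apply/(measurable_restrictT _ _).1 => //; exact: measurable_funTS.
rewrite (fubini_tonelli _ mh h0).
rewrite -ge0_integralZl//; last 3 first.
- apply: (measurable_funS (E := setT)) => //; apply/measurable_EFinP.
  by apply: measurable_funM; [exact: measurable_powR|exact: measurableT_comp].
- by move=> t _; rewrite lee_fin mulr_ge0 ?powR_ge0 ?expR_ge0.
- by rewrite mule_ge0// lee_fin invr_ge0 exprn_ge0// ltW.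
rewrite [leLHS]integral_mkcond.
rewrite le_eqVlt; apply/orP; left; apply/eqP; apply: eq_integral => t _.
rewrite patchE; case: ifPn => tW; last first.
  rewrite integral0_eq// => g _; rewrite /h/=; congr EFin.
  by rewrite [X in _ * (_ * X)]indicE (negbTE tW) !mulr0.
have t0 : 0 < t by move: tW; rewrite inE /W/= in_itv/= => /andP[/(lt_le_trans lo0)].
have st : 0 < s t by rewrite mulr_gt0// powR_gt0.
have stn : (s t) ^- n = om ^- n * t `^ (n%:R / p).
  rewrite /s exprMn invfM; congr (_ * _).
  rewrite -powR_mulrn ?powR_ge0// -powRrM -powRN; congr (_ `^ _).
  by field; rewrite gt_eqF.
transitivity (\int[borel_lebesgue R n]_g
    ((expR (- t))%:E * (\1_A (map_tuple ( *%R (s t)) g))%:E))%E; last first.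
  apply: eq_integral => g _; rewrite /h/= -EFinM; congr EFin.
  by rewrite [X in _ * (_ * X)]indicE tW mulr1 mulrC.
rewrite ge0_integralZl//; last first.
  apply/measurable_EFinP; apply: (measurableT_comp mA1); exact: measurable_scale1.
have -> : (\int[borel_lebesgue R n]_g (\1_A (map_tuple ( *%R (s t)) g))%:E =
    ((s t) ^- n)%:E * borel_lebesgue R n A)%E.
  rewrite (@ge0_integral_scale R n (s t) (fun x => (\1_A x)%:E))//.
    by rewrite integral_indic// setIT.
  exact/measurable_EFinP.
rewrite stn EFinM EFinM.
by rewrite [RHS]muleC (muleC _ (borel_lebesgue R n A)) !muleA.
Qed.

(** * Distances between bodies *)

Lemma omega_pow n : (0 < n)%N -> omega p n ^+ n = Gamma (1 + n%:R / p) / Zrho ^+ n.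
Proof.
move=> n0; have np0 : 0 < n%:R / p by rewrite divr_gt0// ltr0n.
rewrite /omega -Zrho_Gamma expr_div_n -(powR_mulrn n (powR_ge0 _ _)) -powRrM mulVf.
  by rewrite powRr1// ltW// Gamma_gt0.
by rewrite pnatr_eq0 -lt0n.
Qed.

Lemma omega_gt0 n : (0 < n)%N -> 0 < omega p n.
Proof.
move=> n0; have np0 : 0 < n%:R / p by rewrite divr_gt0// ltr0n.
by rewrite /omega -Zrho_Gamma divr_gt0 ?Zrho_gt0// powR_gt0// Gamma_gt0.
Qed.

Lemma omega_le n : (0 < n)%N -> omega p n <= 2 * (2 * (n%:R / p)) `^ p^-1 / Zrho.
Proof.
move=> n0; have n0' : 0 < n%:R :> R by rewrite ltr0n.
have np0 : 0 < n%:R / p by rewrite divr_gt0.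
rewrite /omega -Zrho_Gamma ler_pM2r ?invr_gt0 ?Zrho_gt0//.
have nV0 : 0 <= n%:R^-1 :> R by rewrite invr_ge0 ltW.
apply: (@le_trans _ _ ((2 * (2 * (n%:R / p)) `^ (n%:R / p)) `^ n%:R^-1)).
  by rewrite ge0_ler_powR ?nnegrE ?Gamma_ge0 ?mulr_ge0 ?powR_ge0// Gamma_le.
rewrite powRM ?powR_ge0// ler_pM ?powR_ge0//.
  by rewrite ler1_powR ?ler1n// invf_le1// ler1n.
by rewrite -powRrM mulrAC divff ?mul1r ?gt_eqF.
Qed.

Lemma euclidean_dist_ge0 n (x y : Rvec R n) : 0 <= euclidean_dist x y.
Proof. exact: sqrtr_ge0. Qed.

Lemma euclidean_dist_sqr n (x y : Rvec R n) :
  euclidean_dist x y ^+ 2 = \sum_(i < n) ((tnth x i : R) - tnth y i) ^+ 2.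
Proof. by rewrite sqr_sqrtr// sumr_ge0// => i _; rewrite sqr_ge0. Qed.

Lemma sqr_norm_le n (x y : Rvec R n) :
  sqr_norm y <= 2 * sqr_norm x + 2 * euclidean_dist x y ^+ 2.
Proof.
rewrite euclidean_dist_sqr /sqr_norm !mulr_sumr -big_split/=.
apply: ler_sum => i _; move: (tnth x i : R) (tnth y i : R) => a b.
by have := sqr_ge0 (2 * a - b); nra.
Qed.

Lemma euclidean_dist_scale n (a b : R) (g h : Rvec R n) :
  euclidean_dist (map_tuple ( *%R a) g : Rvec R n) (map_tuple ( *%R b) h) ^+ 2 <=
  2 * a ^+ 2 * euclidean_dist g h ^+ 2 + 2 * (a - b) ^+ 2 * sqr_norm h.
Proof.
rewrite !euclidean_dist_sqr /sqr_norm !mulr_sumr -big_split/=.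
apply: ler_sum => i _; rewrite !tnth_map; move: (tnth g i : R) (tnth h i : R) => u v.
have -> : a * u - b * v = a * (u - v) + (a - b) * v by ring.
by have := sqr_ge0 (a * (u - v) - (a - b) * v); nra.
Qed.

Lemma set_dist_le n (A B : set (Rvec R n)) (x y : Rvec R n) : A x -> B y ->
  set_dist A B <= euclidean_dist x y.
Proof.
move=> Ax By; apply: ge_inf; last by exists x => //; exists y.
by exists 0 => _ [u _ [v _ <-]]; exact: euclidean_dist_ge0.
Qed.

Lemma dilate_lp_ball_coord n (om : R) (x : Rvec R n) (i : 'I_n) : 0 <= om ->
  dilate om (lp_ball p n) x -> - om <= (tnth x i : R) <= om.
Proof.
move=> om0 [y yK <-]; rewrite tnth_map -ler_norml normrM (ger0_norm om0) ler_piMr//.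
rewrite leNgt; apply/negP => y1.
have : 1 < `|tnth y i : R| `^ p.
  rewrite -[ltLHS](congr1 (fun f : R -> R => f p) (powR1 R)).
  by apply: (gt0_ltr_powR p0) => //; rewrite nnegrE.
apply/negP; rewrite -leNgt; apply: le_trans yK.
rewrite (bigD1 i)//= lerDl; apply: sumr_ge0 => j _; exact: powR_ge0.
Qed.

Lemma euclidean_dist_coord_le n (k : R) (x y : Rvec R n) : 0 <= k ->
  (forall i, - k <= (tnth x i : R) <= k) -> (forall i, - k <= (tnth y i : R) <= k) ->
  euclidean_dist x y <= 2 * n%:R * k.
Proof.
move=> k0 Hx Hy.
rewrite -(ler_pXn2r (n := 2))// ?nnegrE ?euclidean_dist_ge0 ?mulr_ge0//.
rewrite euclidean_dist_sqr; apply: (@le_trans _ _ (\sum_(i < n) (2 * k) ^+ 2)).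
  apply: ler_sum => i _; have /andP[x1 x2] := Hx i; have /andP[y1 y2] := Hy i.
  by move: (tnth x i : R) (tnth y i : R) x1 x2 y1 y2 => u v *; nra.
rewrite sumr_const card_ord -[leLHS]mulr_natl.
have -> : (2 * n%:R * k) ^+ 2 = n%:R ^+ 2 * (2 * k) ^+ 2 by ring.
rewrite ler_wpM2r ?sqr_ge0// -natrX ler_nat.
by case: n {x y Hx Hy} => // n; rewrite leq_pmull.
Qed.

(** Powers with exponent 1/p <= 1 do not increase the distance to 1, and the
    ratio t / t' is within 8 r / (r^2 - 4 r) <= 16 / r of 1. *)
Lemma powR_ratio (al r t t' : R) : r ^+ 2 = al -> 8 <= r ->
  al - 4 * r <= t <= al + 4 * r -> al - 4 * r <= t' <= al + 4 * r ->
  `|t `^ (- p^-1) - t' `^ (- p^-1)| <= t `^ (- p^-1) * (16 / r).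
Proof.
move=> ral r8 /andP[t1 t2] /andP[s1 s2].
have pV : 0 < p^-1 <= 1 by rewrite invr_gt0 p0 invf_le1.
have t0 : 0 < t by nra.
have s0 : 0 < t' by nra.
have u0 : 0 < t / t' by rewrite divr_gt0.
have -> : t' `^ (- p^-1) = t `^ (- p^-1) * (t / t') `^ p^-1.
  rewrite powRM ?(ltW t0) ?invr_ge0 ?(ltW s0)// mulrA -powRD ?(gt_eqF t0) ?implybT//.
  by rewrite addNr powRr0 mul1r -(powR_inv1 (ltW s0)) -powRrM mulN1r.
rewrite -{1}(mulr1 (t `^ _)) -mulrBr normrM ger0_norm ?powR_ge0// ler_wpM2l ?powR_ge0//.
apply: (@le_trans _ _ `|1 - t / t'|).
  have [u1|u1] := leP (t / t') 1.
    have h1 : (t / t') `^ p^-1 <= 1.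
      rewrite -[leRHS](congr1 (fun f : R -> R => f p^-1) (powR1 R)).
      by rewrite ge0_ler_powR ?nnegrE ?(ltW u0)//; case/andP: pV => /ltW.
    rewrite !ger0_norm ?subr_ge0// lerB// ger1_powR ?u0//; by case/andP: pV.
  have h1 : 1 <= (t / t') `^ p^-1.
    rewrite -[leLHS](congr1 (fun f : R -> R => f p^-1) (powR1 R)).
    by rewrite ge0_ler_powR ?nnegrE ?(ltW u0) ?(ltW u1)//; case/andP: pV => /ltW.
  rewrite !ler0_norm ?subr_le0 ?(ltW u1)// lerN2 lerB// ler1_powR ?(ltW u1)//; by case/andP: pV.
have -> : 1 - t / t' = (t' - t) / t' by field; rewrite gt_eqF.
rewrite normrM normfV (ger0_norm (ltW s0)) ler_pdivrMr// ler_norml.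
have r0 : 0 < r by lra.
have H : 8 * r <= 16 / r * t' by rewrite mulrAC ler_pdivlMr//; nra.
by apply/andP; split; lra.
Qed.

(** [lift_set] on the Gamma window; the powers of [omega p n] turn the Gamma
    factor into [Zrho ^+ n]. *)
Lemma lifted_mass n (e r : R) (A : set (Rvec R n)) : (0 < n)%N -> 0 < e ->
  64 <= 1 + n%:R / p -> r = Num.sqrt (1 + n%:R / p) ->
  measurable A -> A `<=` dilate (omega p n) (lp_ball p n) ->
  ((e / 2)%:E <= borel_lebesgue R n A)%E ->
  exists At : set (Rvec R n), [/\ measurable At,
    (forall g, At g -> exists2 t, 1 + n%:R / p - 4 * r <= t <= 1 + n%:R / p + 4 * r &
       A (map_tuple ( *%R (omega p n * t `^ (- p^-1))) g)) &
    ((e / 4 * Zrho ^+ n)%:E <= \int[borel_lebesgue R n]_(x in At) (rhon x)%:E)%E].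
Proof.
move=> n0 e0 al64 rE mA AK lA.
have np0 : 0 < n%:R / p by rewrite divr_gt0// ltr0n.
have om0 := omega_gt0 n0.
have win := gamma_window np0 erefl rE al64.
have rr : r ^+ 2 = 1 + n%:R / p by rewrite rE sqr_sqrtr//; lra.
have r0 : 0 <= r by rewrite rE sqrtr_ge0.
have lo0 : 0 < 1 + n%:R / p - 4 * r by nra.
have [At [mAt AtA mass]] := @lift_set n _ _ (1 + n%:R / p + 4 * r) A om0 lo0 mA AK.
exists At; split => //; apply: le_trans mass.
have G0 := Gamma_gt0 np0.
have Z0 := Zrho_gt0.
have -> : (e / 4 * Zrho ^+ n)%:E =
    ((e / 2)%:E * (omega p n ^- n)%:E * (Gamma (1 + n%:R / p) / 2)%:E)%E.
  rewrite -!EFinM omega_pow//; congr EFin.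
  have := exprn_gt0 n Z0; move: (Zrho ^+ n) (Gamma _) G0 => z G G0 z0.
  by field; rewrite !gt_eqF.
have omn : (0 <= (omega p n ^- n)%:E)%E by rewrite lee_fin invr_ge0 exprn_ge0// ltW.
apply: lee_pmul => //.
- by rewrite mule_ge0// lee_fin divr_ge0// ltW.
- by rewrite lee_fin divr_ge0// ltW.
- by rewrite lee_wpmul2r.
Qed.

(** By Markov's inequality the points with |x|^2 < (2 V + 1) n carry at least
    half of the mass, and |y|^2 <= 2 |x|^2 + 2 |x - y|^2 puts them at distance at
    least D from the far set; so [concentration] bounds the mass of the
    latter. *)
Lemma far_mass (c V : R) n (D : R) :
  two_point_bound c ->
  0 <= c -> p <= 2 -> 2 <= D -> (0 < n)%N -> 0 <= V ->
  (\int[borel_lebesgue R n]_x (sqr_norm x * rhon x)%:E <= (n%:R * V * Zrho ^+ n)%:E)%E ->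
  (\int[borel_lebesgue R n]_(x in
      [set x | (2 * ((2 * V + 1) * n%:R) + 2 * D ^+ 2 <= sqr_norm x)%R]) (rhon x)%:E
    <= (2 * Zrho ^+ n * expR (- (c * (D / 2) `^ p)))%:E)%E.
Proof.
move=> gain c0 p2 D2 n0 V0 HV.
have Z0 := exprn_gt0 n Zrho_gt0.
pose T := (2 * V + 1) * n%:R.
have T0 : 0 < T by rewrite mulr_gt0 ?ltr0n//; lra.
have mr (X : set (Rvec R n)) : measurable_fun X (EFin \o @rhon n).
  by apply: (measurable_funS (E := setT)) => //; apply/measurable_EFinP; exact: measurable_rhon.
have r0 (x : Rvec R n) : (0 <= (rhon x)%:E :> \bar R)%E by rewrite lee_fin rhon_ge0.
pose E := ~` [set x : Rvec R n | T <= sqr_norm x].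
have mE : measurable E by apply: measurableC; exact: measurable_sqr_norm_ge.
have Emass : ((Zrho ^+ n / 2)%:E <= \int[borel_lebesgue R n]_(x in E) (rhon x)%:E)%E.
  have : (\int[borel_lebesgue R n]_(x in ~` E) (rhon x)%:E <= (Zrho ^+ n / 2)%:E)%E.
    rewrite setCK.
    have TV : (0 <= (T^-1)%:E)%E by rewrite lee_fin invr_ge0 ltW.
    apply: (@le_trans _ _ ((T^-1)%:E *
        \int[borel_lebesgue R n]_x (sqr_norm x * rhon x)%:E)%E); last first.
      apply: (@le_trans _ _ ((T^-1)%:E * (n%:R * V * Zrho ^+ n)%:E)%E).
        exact: lee_wpmul2l.
      rewrite -EFinM lee_fin /T.
      have n1 : 0 < n%:R :> R by rewrite ltr0n.
      rewrite mulrC ler_pdivrMr//; move: (Zrho ^+ n) Z0 => z z0.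
      by have := mulr_gt0 n1 z0; nra.
    rewrite -ge0_integralZl//; last 2 first.
    - apply/measurable_EFinP/measurable_funM; [exact: measurable_sqr_norm|exact: measurable_rhon].
    - by move=> x _; rewrite lee_fin mulr_ge0 ?sqr_norm_ge0 ?rhon_ge0.
    rewrite [leLHS]integral_mkcond; apply: ge0_le_integral => //.
    - by move=> x _; apply: erestrict_ge0 => y _; exact: r0.
    - by apply/(measurable_restrictT _ _).1 => //; exact: measurable_sqr_norm_ge.
    - apply: emeasurable_funM => //; apply/measurable_EFinP.
      by apply: measurable_funM; [exact: measurable_sqr_norm|exact: measurable_rhon].
    move=> x _; rewrite patchE; case: ifPn => [|_]; last first.
      by rewrite -EFinM lee_fin mulr_ge0 ?invr_ge0 ?(ltW T0)// mulr_ge0 ?sqr_norm_ge0 ?rhon_ge0.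
    rewrite inE/= => Tx; rewrite -EFinM lee_fin mulrA ler_peMl ?rhon_ge0//.
    by rewrite mulrC ler_pdivlMr// mul1r.
  have := mass_rhon n; rewrite -(setUv E) ge0_integral_setU//; last 2 first.
  - exact: measurableC.
  - by rewrite disj_set2E setICr.
  move=> eqZ H; rewrite -(leeD2rE (x := \int[borel_lebesgue R n]_(x in ~` E) (rhon x)%:E)).
    rewrite eqZ; apply: le_trans (leeD2l _ H) _.
    by rewrite -EFinD lee_fin; lra.
  rewrite ge0_fin_numE; first by apply: le_lt_trans H _; rewrite ltry.
  exact: integral_ge0.
pose F := [set x : Rvec R n | 2 * T + 2 * D ^+ 2 <= sqr_norm x].
have := @concentration c n E F D gain c0 p2 D2 mE (measurable_sqr_norm_ge _).
rewrite -/F => conc.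
have {}conc : ((\int[borel_lebesgue R n]_(x in E) (rhon x)%:E) *
   (\int[borel_lebesgue R n]_(x in F) (rhon x)%:E) <=
   (Zrho ^+ (2 * n) * expR (- (c * (D / 2) `^ p)))%:E)%E.
  apply: conc => x y; rewrite /E /F /= => /negP; rewrite -ltNge => xE yF.
  rewrite -(ler_pXn2r (n := 2))// ?nnegrE ?euclidean_dist_ge0//; last by lra.
  by have := sqr_norm_le x y; lra.
have Zh : 0 < Zrho ^+ n / 2 by rewrite divr_gt0.
rewrite -/T -/F.
rewrite -(lee_pmul2l (x := (Zrho ^+ n / 2)%:E))//.
apply: (@le_trans _ _ (Zrho ^+ (2 * n) * expR (- (c * (D / 2) `^ p)))%:E).
  apply: le_trans conc; apply: lee_wpmul2r => //; exact: integral_ge0.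
by rewrite -EFinM lee_fin mul2n -addnn exprD le_eqVlt; apply/orP; left; apply/eqP; field.
Qed.

(** a g - b h = a (g - h) + (a - b) h, where the factors a and b are at most
    8 / Zrho and differ by at most a (16 / r).  Since r^2 = 1 + n/p, the square
    of the second term is of the order of |h|^2 / n, which is O(D^2) by the
    bound on h and D >= 2. *)
Lemma scale_point_close n (r V D t t' : R) (g h : Rvec R n) : p <= 2 -> (0 < n)%N ->
  64 <= 1 + n%:R / p -> r = Num.sqrt (1 + n%:R / p) -> 0 <= V -> 2 <= D ->
  1 + n%:R / p - 4 * r <= t <= 1 + n%:R / p + 4 * r ->
  1 + n%:R / p - 4 * r <= t' <= 1 + n%:R / p + 4 * r ->
  euclidean_dist g h <= D ->
  sqr_norm h <= 2 * (V * n%:R) + 2 * D ^+ 2 ->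
  euclidean_dist (map_tuple ( *%R (omega p n * t `^ (- p^-1))) g : Rvec R n)
    (map_tuple ( *%R (omega p n * t' `^ (- p^-1))) h) <=
  8 / Zrho * Num.sqrt (18 + 512 * V) * D.
Proof.
move=> p2 n0 al64 rE V0 D2 tW tW' ghD hV.
have Z0 := Zrho_gt0.
have n1 : 0 < n%:R :> R by rewrite ltr0n.
have np0 : 0 < n%:R / p by rewrite divr_gt0.
have om0 := omega_gt0 n0.
have rr : r ^+ 2 = 1 + n%:R / p by rewrite rE sqr_sqrtr//; lra.
have r0 : 0 <= r by rewrite rE sqrtr_ge0.
have r8 : 8 <= r by nra.
have t_ge : 2^-1 * (n%:R / p) <= t by case/andP: tW => t1 _; nra.
have half0 : 0 < 2^-1 * (n%:R / p) by rewrite mulr_gt0// invr_gt0.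
have t0 : 0 < t by exact: lt_le_trans t_ge.
pose a := omega p n * t `^ (- p^-1).
pose b := omega p n * t' `^ (- p^-1).
have a0 : 0 < a by rewrite mulr_gt0// powR_gt0.
have pV : 0 <= p^-1 <= 1 by rewrite invr_ge0 (ltW p0) invf_le1.
have a8 : a <= 8 / Zrho.
  have h1 : t `^ (- p^-1) <= (2^-1 * (n%:R / p)) `^ (- p^-1).
    rewrite !powRN lef_pV2 ?posrE ?powR_gt0//.
    by rewrite ge0_ler_powR ?nnegrE ?(ltW half0) ?(ltW t0)//; case/andP: pV.
  have h2 : (2 * (n%:R / p)) `^ p^-1 * (2^-1 * (n%:R / p)) `^ (- p^-1) <= 4.
    have -> : (2^-1 * (n%:R / p)) `^ (- p^-1) = (2^-1 * (n%:R / p))^-1 `^ p^-1.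
      by rewrite -(powR_inv1 (ltW half0)) -powRrM mulN1r.
    rewrite -powRM ?invr_ge0 ?(ltW half0)//; last by rewrite mulr_ge0 ?(ltW np0).
    have -> : 2 * (n%:R / p) * (2^-1 * (n%:R / p))^-1 = 4.
      by field; rewrite (gt_eqF n1) (gt_eqF p0).
    by rewrite ler1_powR ?ler1n//; case/andP: pV.
  apply: le_trans (ler_pM (ltW om0) (powR_ge0 _ _) (omega_le n0) h1) _.
  have ZV : 0 <= 2 / Zrho by rewrite divr_ge0// ltW.
  have := ler_wpM2l ZV h2.
  by move: ((2 * _) `^ _) (_ `^ (- p^-1)) => u v; lra.
have ab : (a - b) ^+ 2 <= (8 / Zrho * (16 / r)) ^+ 2.
  rewrite -[leLHS]real_normK ?num_real// ler_pXn2r ?nnegrE//; last first.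
    by rewrite mulr_ge0 ?divr_ge0 ?(ltW Z0).
  rewrite /a /b -mulrBr normrM (ger0_norm (ltW om0)).
  apply: (@le_trans _ _ (a * (16 / r))).
    rewrite /a -mulrA ler_wpM2l ?(ltW om0)//; exact: powR_ratio rr r8 tW tW'.
  by rewrite ler_wpM2r// divr_ge0.
have a8s : a ^+ 2 <= (8 / Zrho) ^+ 2.
  by rewrite ler_pXn2r ?nnegrE ?(ltW a0) ?divr_ge0 ?(ltW Z0).
have gs : euclidean_dist g h ^+ 2 <= D ^+ 2.
  by rewrite ler_pXn2r ?nnegrE ?euclidean_dist_ge0//; lra.
have nr : n%:R <= 2 * r ^+ 2.
  have : n%:R = p * (n%:R / p) by field; rewrite gt_eqF.
  rewrite rr; move: (n%:R / p) np0 => u u0 ->; nra.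
have D0 : 0 <= D by lra.
have V18 : 0 <= 18 + 512 * V by nra.
have ZD : 0 <= 8 / Zrho * Num.sqrt (18 + 512 * V) * D.
  by apply: mulr_ge0 D0; apply: mulr_ge0 (sqrtr_ge0 _); exact: divr_ge0 (ler0n _ _) (ltW Z0).
rewrite -(ler_pXn2r (n := 2))// ?nnegrE ?euclidean_dist_ge0//.
apply: le_trans (euclidean_dist_scale _ _ _ _) _.
rewrite -/a -/b [leRHS]exprMn [X in _ <= X * _]exprMn (sqr_sqrtr V18).
have sh0 := sqr_norm_ge0 h.
rewrite exprMn in ab.
have q2r : (16 / r) ^+ 2 * r ^+ 2 = 256 by field; rewrite gt_eqF//; lra.
have q20 : 0 <= (16 / r) ^+ 2 by exact: sqr_ge0.
have r64 : 64 <= r ^+ 2 by rewrite rr.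
have q24 : (16 / r) ^+ 2 <= 4 by nra.
have q2n : (16 / r) ^+ 2 * n%:R <= 512 by have := ler_wpM2l q20 nr; lra.
have d4 : 4 <= D ^+ 2 by nra.
have s0 : 0 <= euclidean_dist g h ^+ 2 by exact: sqr_ge0.
have z20 : 0 <= (8 / Zrho) ^+ 2 by exact: sqr_ge0.
move: ((8 / Zrho) ^+ 2) (a ^+ 2) (sqr_ge0 a) ((a - b) ^+ 2) (sqr_ge0 (a - b)) z20 a8s ab.
move: ((16 / r) ^+ 2) q20 q24 q2n => q q0 q4 qn.
move: (euclidean_dist g h ^+ 2) (D ^+ 2) (sqr_norm h) gs hV sh0 d4 s0.
move=> S d N Sd NV N0 d4 S0 z a2 a20 b2 b20 z0 a2z b2z.
have h1 : a2 * S <= z * d by exact: ler_pM.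
have h2 : b2 * N <= z * q * (2 * (V * n%:R) + 2 * d) by exact: ler_pM.
have h3 : q * (2 * (V * n%:R) + 2 * d) <= (256 * V + 8) * d.
  have : V * (q * n%:R) <= V * 512 by rewrite ler_wpM2l.
  have : q * d <= 4 * d by rewrite ler_wpM2r//; lra.
  have : V * 4 <= V * d by rewrite ler_wpM2l.
  lra.
have h4 := ler_wpM2l z0 h3.
lra.
Qed.

(** The constant K makes the concentration bound at distance
    D = 2 (K log(1/eps))^(1/p) at most eps^8.  This is less than the product of
    the masses of the two lifted sets, and small enough to remove the far
    points from one of them at little cost. *)
Lemma bodies_close : p <= 2 -> exists2 C : R, 0 < C &
  forall (n : nat) (eps : R) (A B : set (Rvec R n)),
      (1 <= n)%N -> 0 < eps < 2^-1 ->
      lebesgue_measurable A -> lebesgue_measurable B ->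
      A `<=` dilate (omega p n) (lp_ball p n) ->
      B `<=` dilate (omega p n) (lp_ball p n) ->
      lebesgue_Rn A = eps%:E -> lebesgue_Rn B = eps%:E ->
      set_dist A B <= C * ln (eps^-1) `^ p^-1.
Proof.
move=> p2.
have [c c0 gain] := two_point_gain.
have [V V0 HV] := second_moment_rhon.
have Z0 := Zrho_gt0.
have pV : 0 < p^-1 <= 1 by rewrite invr_gt0 p0 invf_le1.
(* The far points are those of squared norm above 2 M n + 2 D^2. *)
pose M := 2 * V + 1.
have M0 : 0 <= M by rewrite /M; lra.
(* In small dimension: 1 + n/p < 64 forces n < 63 p <= 126. *)
have [N N0 HN] : exists2 N : R, 0 < N & forall n : nat, (0 < n)%N -> 1 + n%:R / p < 64 -> n%:R <= N.
  exists 128 => [|n n0 np]; first by rewrite ltr0n.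
  have : n%:R = p * (n%:R / p) :> R by field; rewrite gt_eqF.
  have : 0 <= n%:R / p by rewrite divr_ge0// ltW.
  move: (n%:R / p) np => u; nra.
(* c K >= 8 gives the bound eps^8; K >= 2 ensures that D >= 2, because
   L >= 1/2. *)
pose K := 8 / c + 2.
have K2 : 2 <= K by rewrite lerDr divr_ge0// ltW.
have cK : 8 <= c * K by rewrite /K mulrDr mulrCA divff ?gt_eqF// mulr1 lerDl mulr_ge0// ltW.
pose Ca := 8 / Zrho * Num.sqrt (18 + 512 * M) * (2 * K `^ p^-1).
pose Cb := 2 * (2 * N * (4 * N / Zrho)).
have Ca0 : 0 <= Ca.
  apply: mulr_ge0; last by rewrite mulr_ge0 ?powR_ge0.
  by apply: mulr_ge0 (sqrtr_ge0 _); exact: divr_ge0 (ler0n _ _) (ltW Z0).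
have Cb0 : 0 < Cb by rewrite /Cb !mulr_gt0 ?invr_gt0.
exists (Ca + Cb) => [|n e A B n0 /andP[e0 e2] mA mB AK BK lA lB]; first by rewrite ltr_wpDl.
set L := ln e^-1.
have eL : e = expR (- L) by rewrite /L lnV ?posrE// opprK lnK ?posrE.
have L2 : 2^-1 <= L.
  rewrite -(ler_expR) /L lnK ?posrE ?invr_gt0//.
  have : expR 2^-1 <= 1 + 2 * 2^-1 :> R by apply: expR_le_1D2x; rewrite invr_ge0 lexx andbT.
  move/le_trans; apply; rewrite mulfV ?pnatr_eq0//.
  have := e2; rewrite -(ltf_pV2 (x := 2^-1)) ?posrE ?invr_gt0// invrK => /ltW.
  by lra.
have Lp : 2^-1 <= L `^ p^-1.
  apply: (@le_trans _ _ (2^-1 `^ p^-1)).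
    by rewrite ger1_powR ?invr_gt0 ?invf_le1 ?ler1n ?ltr0n//; case/andP: pV.
  by rewrite ge0_ler_powR ?nnegrE ?(ltW (proj1 (andP pV)))//; lra.
have om0 := omega_gt0 n0.
have coord X x i : X `<=` dilate (omega p n) (lp_ball p n) -> X x ->
    - omega p n <= (tnth x i : R) <= omega p n.
  by move=> XK Xx; apply: dilate_lp_ball_coord (ltW om0) (XK _ Xx).
have [A0 [mA0 A0A lA0]] := borel_inner e0 mA lA (fun x i => coord A x i AK).
have [B0 [mB0 B0B lB0]] := borel_inner e0 mB lB (fun x i => coord B x i BK).
have nonempty X : ((e / 2)%:E <= borel_lebesgue R n X)%E -> exists x, X x.
  move=> lX; apply: contrapT => H; have X0 : X = set0.
    by apply/seteqP; split => // x Xx; apply: H; exists x.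
  by move: lX; rewrite X0 measure0 lee_fin leNgt divr_gt0.
have [al64|al64] := ltP (1 + n%:R / p) 64.
  have [x A0x] := nonempty _ lA0. have [y B0y] := nonempty _ lB0.
  apply: le_trans (set_dist_le (A0A _ A0x) (B0B _ B0y)) _.
  apply: le_trans (euclidean_dist_coord_le (ltW om0)
    (fun i => coord A x i AK (A0A _ A0x)) (fun i => coord B y i BK (B0B _ B0y))) _.
  have nN := HN n n0 al64.
  have omN : omega p n <= 4 * N / Zrho.
    apply: le_trans (omega_le n0) _; rewrite ler_pM2r ?invr_gt0//.
    have n1 : 1 <= n%:R :> R by rewrite ler1n.
    have np : n%:R / p <= n%:R by rewrite ler_pdivrMr// ler_peMr//; lra.
    have np2 : 1 <= 2 * (n%:R / p).
      by rewrite mulrA ler_pdivlMr// mul1r; lra.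
    have := ler1_powR np2 (proj2 (andP pV)); lra.
  apply: (@le_trans _ _ (2 * N * (4 * N / Zrho))).
    by apply: ler_pM omN; rewrite ?(ltW om0) ?mulr_ge0// ler_wpM2l.
  have Cb2 : 2 * N * (4 * N / Zrho) = Cb * 2^-1 by rewrite /Cb; field; rewrite gt_eqF.
  rewrite Cb2 mulrDl; apply: ler_wpDl; first by rewrite mulr_ge0// powR_ge0.
  by rewrite ler_wpM2l// ltW.
pose r : R := Num.sqrt (1 + n%:R / p).
have [At [mAt AtA lAt]] := lifted_mass n0 e0 al64 (erefl r) mA0 (subset_trans A0A AK) lA0.
have [Bt [mBt BtB lBt]] := lifted_mass n0 e0 al64 (erefl r) mB0 (subset_trans B0B BK) lB0.
have L0 : 0 <= L by lra.
have K0 : 0 <= K by lra.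
have KL1 : 1 <= K * L by nra.
pose D := 2 * (K * L) `^ p^-1.
have Dp : (D / 2) `^ p = K * L.
  rewrite /D mulrC mulrA mulVf ?mul1r ?pnatr_eq0// -powRrM mulVf ?gt_eqF//.
  by rewrite powRr1// mulr_ge0.
have D2 : 2 <= D.
  rewrite /D ler_peMr// -[leLHS](powRr0 (K * L)) ler_powR//.
  by case/andP: pV => /ltW.
have Zn0 := exprn_gt0 n Z0.
have e8 : expR (- (c * (D / 2) `^ p)) <= e ^+ 8.
  rewrite Dp eL -expRM_natl ler_expR mulrN lerN2 mulrA.
  by rewrite ler_wpM2r.
pose F := [set x : Rvec R n | 2 * (M * n%:R) + 2 * D ^+ 2 <= sqr_norm x].
have lF := far_mass gain (ltW c0) p2 D2 n0 V0 (HV n).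
rewrite -/M -/F in lF.
have mF : measurable F by exact: measurable_sqr_norm_ge.
have mr (X : set (Rvec R n)) : measurable_fun X (EFin \o @rhon n).
  by apply: (measurable_funS (E := setT)) => //; apply/measurable_EFinP; exact: measurable_rhon.
have r0 (x : Rvec R n) : (0 <= (rhon x)%:E :> \bar R)%E by rewrite lee_fin rhon_ge0.
have e8s : 2 * e ^+ 8 <= e / 8.
  have e27 : e ^+ 7 <= 2^-1 ^+ 7 by rewrite ler_pXn2r ?nnegrE ?(ltW e0) ?(ltW e2)// invr_ge0.
  have : e * e ^+ 7 <= e * 2^-1 ^+ 7 by rewrite ler_wpM2l// ltW.
  rewrite -exprS; move: (e ^+ 8) => w; lra.
(* As eps < 1/2, the far points, of mass at most 2 eps^8, leave half of the
   mass of Bt. *)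
pose B2 := Bt `\` F.
have mB2 : measurable B2 by exact: measurableD.
have lB2 : ((e / 8 * Zrho ^+ n)%:E <= \int[borel_lebesgue R n]_(x in B2) (rhon x)%:E)%E.
  have I2 : (0 <= \int[borel_lebesgue R n]_(x in B2) (rhon x)%:E)%E by exact: integral_ge0.
  have : ((e / 4 * Zrho ^+ n)%:E <= \int[borel_lebesgue R n]_(x in B2) (rhon x)%:E +
     (e / 8 * Zrho ^+ n)%:E)%E.
    apply: le_trans lBt _.
    apply: (@le_trans _ _ (\int[borel_lebesgue R n]_(x in B2) (rhon x)%:E +
      \int[borel_lebesgue R n]_(x in F) (rhon x)%:E)%E).
      rewrite -ge0_integral_setU//; last first.
        by rewrite disj_set2E /B2 setDE -setIA setICl setI0.
      apply: ge0_subset_integral => //; first exact: measurableU.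
      by move=> x Bx; have [Fx|Fx] := pselect (F x); [right|left].
    rewrite leeD2l//; apply: le_trans lF _; rewrite lee_fin mulrAC ler_wpM2r ?(ltW Zn0)//.
    by apply: le_trans e8s; rewrite ler_wpM2l.
  move: I2; case: (integral _ _ _) => [z| |]//; rewrite ?leey//.
  by move=> _; rewrite -EFinD !lee_fin; lra.
have [[g [h [Ag Bh ghD]]]|far] :=
    pselect (exists g h, [/\ At g, B2 h & euclidean_dist g h <= D]); last first.
  exfalso.
  have conc := concentration gain (ltW c0) p2 D2 mAt mB2.
  have {}conc : ((\int[borel_lebesgue R n]_(x in At) (rhon x)%:E) *
     (\int[borel_lebesgue R n]_(x in B2) (rhon x)%:E) <=
     (Zrho ^+ (2 * n) * expR (- (c * (D / 2) `^ p)))%:E)%E.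
    apply: conc => x y Ax By; rewrite leNgt; apply/negP => xy.
    by apply: far; exists x, y; split => //; exact: ltW.
  have : ((e / 4 * Zrho ^+ n)%:E * (e / 8 * Zrho ^+ n)%:E <= (Zrho ^+ (2 * n) * e ^+ 8)%:E)%E.
    apply: le_trans (lee_pmul _ _ lAt lB2) _.
    - by rewrite lee_fin mulr_ge0 ?divr_ge0 ?(ltW e0) ?(ltW Zn0).
    - by rewrite lee_fin mulr_ge0 ?divr_ge0 ?(ltW e0) ?(ltW Zn0).
    - apply: le_trans conc _; rewrite lee_fin ler_wpM2l// exprn_ge0// ltW//.
  rewrite -EFinM lee_fin mul2n -addnn exprD leNgt => /negP; apply.
  have : 0 < Zrho ^+ n * Zrho ^+ n by rewrite mulr_gt0.
  have -> : e / 4 * Zrho ^+ n * (e / 8 * Zrho ^+ n) =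
      Zrho ^+ n * Zrho ^+ n * (e * (e / 32)) by field.
  move=> zz; rewrite ltr_pM2l// exprS ltr_pM2l//.
  have e26 : e ^+ 6 <= 2^-1 ^+ 6 by rewrite ler_pXn2r ?nnegrE ?(ltW e0) ?(ltW e2)// invr_ge0.
  have : e * e ^+ 6 <= e * 2^-1 ^+ 6 by rewrite ler_wpM2l// ltW.
  rewrite -exprS; move: (e ^+ 7) => w; lra.
have [t tW At'] := AtA g Ag.
have [Bth /= Fh] := Bh.
have [t' tW' Bt'] := BtB h Bth.
apply: le_trans (set_dist_le (A0A _ At') (B0B _ Bt')) _.
have hM : sqr_norm h <= 2 * (M * n%:R) + 2 * D ^+ 2.
  by move/negP: Fh; rewrite -ltNge => /ltW.
apply: le_trans (scale_point_close p2 n0 al64 erefl M0 D2 tW tW' ghD hM) _.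
have -> : 8 / Zrho * Num.sqrt (18 + 512 * M) * D = Ca * L `^ p^-1.
  by rewrite /Ca /D powRM// !mulrA.
by rewrite mulrDl lerDl mulr_ge0 ?powR_ge0// ltW.
Qed.

End density.

Theorem theorem5p8 (R : realType) (p : R) (hp : 1 <= p <= 2) :
  exists2 C : R, 0 < C &
    forall (n : nat) (eps : R) (A B : set (Rvec R n)),
      (1 <= n)%N -> 0 < eps < 2^-1 ->
      lebesgue_measurable A -> lebesgue_measurable B ->
      A `<=` dilate (omega p n) (lp_ball p n) ->
      B `<=` dilate (omega p n) (lp_ball p n) ->
      lebesgue_Rn A = eps%:E -> lebesgue_Rn B = eps%:E ->
      set_dist A B <= C * ln (eps^-1) `^ p^-1.
Proof. by have /andP[p1 p2] := hp; exact: (bodies_close p1 p2). Qed.
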